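(* Let $p$ be a constant with $0<p\le 1/2$ and let $G$ be a random graph in $G(n,p)$. For any positive constants $c$ and $\epsilon$, asymptotically almost surely (as $n\to\infty$) the bipartition number $\tau(G)$ satisfies $$n-c(\log_{1/p} n)^{3+\epsilon}\ \le\ \tau(G)\ \le\ n-(2+o(1))\log_{1/(1-p)} n .$$
   Context: $G(n,p)$ denotes the random graph on $n$ labelled vertices in which each pair of vertices is an edge independently with probability $p$. ''Asymptotically almost surely'' means with probability tending to $1$ as $n\to\infty$. The bipartition number $\tau(G)$ of a graph $G$ is the minimum number of complete bipartite subgraphs of $G$ that are pairwise edge-disjoint and whose union is the edge set of $G$ (stars are allowed as complete bipartite graphs). The term $o(1)$ is a deterministic quantity tending to $0$ as $n\to\infty$ (for fixed $p$). *)

(* Defs.v *)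
From HB Require Import structures.
From mathcomp Require Import all_boot all_order all_algebra.

Set Implicit Arguments.
Unset Strict Implicit.
Unset Printing Implicit Defensive.

Import Order.TTheory GRing.Theory Num.Theory.

Local Open Scope ring_scope.

(* An edge is an unordered pair, encoded as a 2-element set of vertices. *)
Definition pairs (T : finType) : {set {set T}} := [set e : {set T} | #|e| == 2%N].

Record sgraph (T : finType) := SGraph {
  edges : {set {set T}};
  edges_pairs : edges \subset pairs T
}.

HB.instance Definition _ (T : finType) := [isSub for @edges T].
HB.instance Definition _ (T : finType) := [Countable of sgraph T by <:].
HB.instance Definition _ (T : finType) := [Finite of sgraph T by <:].

Section Bipartition.
Variable T : finType.

Definition cross (X Y : {set T}) : {set {set T}} :=
  [set [set x; y] | x in X, y in Y].

(* A complete bipartite graph is represented by its edge set. Both sides are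
   nonempty, so it has no isolated vertex and nothing is lost. A side may be a
   singleton, which gives a star. *)
Definition biclique (B : {set {set T}}) : bool :=
  [exists X : {set T}, exists Y : {set T},
    [&& X != set0, Y != set0, [disjoint X & Y] & B == cross X Y]].

(* [partition P (edges G)] says that the members of [P] are nonempty, pairwise
   disjoint, and have union [edges G]. *)
Definition biclique_partition (G : sgraph T) (P : {set {set {set T}}}) : bool :=
  partition P (edges G) && [forall B in P, biclique B].

Lemma biclique1 (e : {set T}) : e \in pairs T -> biclique [set e].
Proof.
rewrite inE => /cards2P[x [y [xy ->]]].
apply/existsP; exists [set x]; apply/existsP; exists [set y].
apply/and4P; split.
- by apply/set0Pn; exists x; rewrite inE.
- by apply/set0Pn; exists y; rewrite inE.
- by rewrite disjoints1 inE.
- apply/eqP/setP => f; rewrite inE; apply/eqP/imset2P => [->|].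
    by exists x y; rewrite ?inE.
  by case=> a b; rewrite !inE => /eqP -> /eqP -> ->.
Qed.

Lemma biclique_partition_ex (G : sgraph T) :
  exists k, [exists P, biclique_partition G P && (#|P| == k)].
Proof.
pose P : {set {set {set T}}} := [set [set e] | e in edges G].
exists #|P|; apply/existsP; exists P; rewrite eqxx andbT.
apply/andP; split.
  apply/and3P; split.
  - rewrite cover_imset; apply/eqP/setP => e.
    apply/bigcupP/idP => [[f fG]|eG]; first by rewrite inE => /eqP ->.
    by exists e; rewrite ?inE.
  - apply/trivIsetP => _ _ /imsetP[e _ ->] /imsetP[f _ ->] ef.
    rewrite disjoints1 inE; apply: contra ef => /eqP ->; exact: eqxx.
  - apply/imsetP => -[e _ /setP/(_ e)]; by rewrite !inE eqxx.
apply/forall_inP => _ /imsetP[e eG ->].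
by apply: biclique1; apply: (subsetP (edges_pairs G)).
Qed.

Definition tau (G : sgraph T) : nat := ex_minn (biclique_partition_ex G).

End Bipartition.

Section RandomGraph.
Variable R : comNzRingType.

(* The law of G(n,p): the product over all pairs of independent Bernoulli(p)
   laws, on the finite sample space of all graphs on ['I_n]. *)
Definition Gnp_weight (n : nat) (p : R) (G : sgraph 'I_n) : R :=
  \prod_(e in pairs 'I_n) (if e \in edges G then p else 1 - p).

Definition Gnp_prob (n : nat) (p : R) (A : pred (sgraph 'I_n)) : R :=
  \sum_(G : sgraph 'I_n | A G) Gnp_weight p G.

Lemma Gnp_prob_subset (n : nat) (p : R) (S : {set {set 'I_n}}) :
  S \subset pairs 'I_n ->
  Gnp_prob p [pred G : sgraph 'I_n | S \subset edges G] = p ^+ #|S|.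
Proof.
move=> sSP.
pose F (e : {set 'I_n}) : R := if e \in pairs 'I_n then p else 0.
pose H (e : {set 'I_n}) : R :=
  if e \in pairs 'I_n then (if e \in S then 0 else 1 - p) else 1.
transitivity (\sum_(J in {set {set 'I_n}}) \prod_e (if e \in J then F e else H e));
  last first.
  rewrite -bigA_distr (bigID (fun e => e \in S)) /= [X in _ * X]big1 => [|e /negbTE eS].
    rewrite mulr1 -prodr_const; apply: eq_bigr => e eS.
    by rewrite /F /H eS (subsetP sSP) // addr0.
  by rewrite /F /H eS; case: ifP => _; rewrite ?add0r // addrC subrK.
rewrite (bigID (fun J : {set {set 'I_n}} => (J \subset pairs 'I_n) && (S \subset J))) /=.
rewrite [X in _ = _ + X]big1 ?addr0 => [|J]; last first.
  rewrite negb_and => /orP[] /subsetPn[e e1 e2]; rewrite (bigD1 e) //=.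
    by rewrite e1 /F (negbTE e2) mul0r.
  by rewrite (negbTE e2) /H (subsetP sSP) // e1 mul0r.
rewrite (reindex_omap (@edges 'I_n) insub) => [|J /andP[JP _]]; last by rewrite insubT.
rewrite /Gnp_prob; apply: eq_big => [[E EP] /=|[E EP] /= SE].
  by rewrite EP insubT /= eqxx andbT.
rewrite /Gnp_weight [RHS](bigID (fun e => e \in pairs 'I_n)) /=.
rewrite [X in _ = _ * X]big1 ?mulr1 => [|e eP]; last first.
  have /negbTE-> : e \notin E by apply: contra eP; apply: (subsetP EP).
  by rewrite /H (negbTE eP).
apply: eq_bigr => e eP; rewrite /F /H eP; case: ifP => // eE.
by case: ifP => // /(subsetP SE); rewrite eE.
Qed.

Lemma Gnp_probT (n : nat) (p : R) : Gnp_prob p [pred _ : sgraph 'I_n | true] = 1.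
Proof.
have := Gnp_prob_subset p (sub0set (pairs 'I_n)).
rewrite cards0 expr0 => <-; apply: eq_bigl => G /=; by rewrite sub0set.
Qed.

End RandomGraph.

From mathcomp Require Import all_classical all_reals all_analysis.
Import numFieldNormedType.Exports.

Section Asymptotics.
Variable R : realType.

Definition logb (b x : R) : R := ln x / ln b.

(* Asymptotically almost surely in G(n,p), with [p] not depending on [n]. *)
Definition aas (p : R) (A : forall n : nat, pred (sgraph 'I_n)) : Prop :=
  ((fun n : nat => Gnp_prob p (A n)) @ \oo --> (1 : R))%classic.

End Asymptotics.

(* Main.v *)
Require Import Defs.
From HB Require Import structures.
From mathcomp Require Import all_boot all_order all_algebra.
From mathcomp Require Import zify ring lra.

(** Upper bound: stars centred outside an independent set [I] partition the edges, so
    [tau G + #|I| <= n], and the second moment method gives an independent set of size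
    [(2 - o(1)) log_{1/(1-p)} n].

    Lower bound: let [tau G < n - k]. Restricting to a suitable vertex set [W] with
    [#|W| >= k] leaves at most [m = #|W|] bicliques, none of them a star. Call the smaller
    side of a biclique its block, and call a biclique ordinary if its block has at most [K]
    vertices and avoids the hubs, the vertices lying in more than [D] such blocks. Fix the
    blocks; this costs only exp(o(m^2)) in a union bound. An ordinary biclique covers an
    edge [uv] only if [v] is adjacent to another vertex of a block of [u], or conversely, so
    on average a positive proportion c0, independent of [K] and [D], of the pairs in [W] are
    edges that no ordinary biclique can cover; by bounded differences this fails with
    probability exp(-c m^2). The other bicliques cannot cover them: those through hubs cover
    few edges, and those with large blocks admit so few choices of their other sides that
    they cover a positive proportion of the pairs only with probability exp(-c m^2). Summing
    over [W] with [#|W| >= k], failure is unlikely as soon as [k] is a large multiple of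
    [log n]. *)

Set Implicit Arguments.
Unset Strict Implicit.
Unset Printing Implicit Defensive.

Import Order.TTheory GRing.Theory Num.Theory.

Local Open Scope ring_scope.

(** * Expectations over a random edge set *)

Section RandomSubset.
Variables (R : realFieldType) (E : finType) (p : R).

(* Expectation of [f] over the random subset of [s] that contains each element
   independently with probability [p], computed by exposing [s] one element at a time. *)
Fixpoint bexp (s : seq E) (f : {set E} -> R) : R :=
  if s is e :: s' then
    p * bexp s' (fun S => f (e |: S)) + (1 - p) * bexp s' (fun S => f (S :\ e))
  else f set0.

Lemma eq_bexp s f g : f =1 g -> bexp s f = bexp s g.
Proof.
elim: s f g => [|e s IH] f g fg /=; first exact: fg.
by congr (_ * _ + _ * _); apply: IH => S; apply: fg.
Qed.

Lemma bexp_cst s (a : R) : bexp s (fun=> a) = a.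
Proof. by elim: s => //= e s ->; ring. Qed.

Lemma bexpD s f g : bexp s (fun S => f S + g S) = bexp s f + bexp s g.
Proof. by elim: s f g => //= e s IH f g; rewrite !IH; ring. Qed.

Lemma bexpZ s (a : R) f : bexp s (fun S => a * f S) = a * bexp s f.
Proof. by elim: s f => //= e s IH f; rewrite !IH; ring. Qed.

Lemma bexp_sum (I : Type) (r : seq I) (P : pred I) s (f : I -> {set E} -> R) :
  bexp s (fun S => \sum_(i <- r | P i) f i S) = \sum_(i <- r | P i) bexp s (f i).
Proof.
elim: r => [|i r IH].
  by rewrite big_nil -[RHS](bexp_cst s); apply: eq_bexp => S; rewrite big_nil.
rewrite big_cons -IH; case: ifP => Pi.
  by rewrite -bexpD; apply: eq_bexp => S; rewrite big_cons Pi.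
by apply: eq_bexp => S; rewrite big_cons Pi.
Qed.

Lemma bexp_prod s (g : E -> bool -> R) : uniq s ->
  bexp s (fun S => \prod_(e <- s) g e (e \in S))
  = \prod_(e <- s) (p * g e true + (1 - p) * g e false).
Proof.
elim: s => [|e s IH] /=; first by rewrite !big_nil.
case/andP=> es us; rewrite big_cons -(IH us) [RHS]mulrDl; congr (_ + _).
  rewrite -mulrA -[in RHS]bexpZ; congr (_ * _); apply: eq_bexp => S.
  rewrite big_cons !inE eqxx /=; congr (_ * _).
  apply: eq_big_seq => x xs; rewrite !inE; case: eqP => // xe.
  by rewrite -xe xs in es.
rewrite -mulrA -[in RHS]bexpZ; congr (_ * _); apply: eq_bexp => S.
rewrite big_cons !inE eqxx /=; congr (_ * _).
apply: eq_big_seq => x xs; rewrite !inE; case: eqP => // xe.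
by rewrite -xe xs in es.
Qed.

(** The indicator is a product with one factor per element of [s], so independence in the form of
    [bexp_prod] evaluates it. *)
Lemma bexp_cylinder s (F Z : {set E}) : uniq s ->
  F \subset s -> Z \subset s -> [disjoint F & Z] ->
  bexp s (fun S => ((F \subset S) && [disjoint Z & S])%:R)
  = p ^+ #|F| * (1 - p) ^+ #|Z|.
Proof.
move=> us Fs Zs FZ.
pose g e b : R := (((e \in F) ==> b) && ((e \in Z) ==> ~~ b))%:R.
rewrite (@eq_bexp _ _ (fun S => \prod_(e <- s) g e (e \in S))); last first.
  move=> S; rewrite /g.
  have -> : (F \subset S) && [disjoint Z & S] =
     all (fun e => ((e \in F) ==> (e \in S)) && ((e \in Z) ==> (e \notin S))) s.
    apply/andP/allP => [[/subsetP FS /pred0P ZS] e es|H].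
      apply/andP; split; apply/implyP; [exact: FS|move=> eZ].
      by have := ZS e; rewrite /= eZ /= => ->.
    split.
      by apply/subsetP => e eF; have /andP[/implyP/(_ eF)] := H e (subsetP Fs _ eF).
    apply/pred0P => e /=; apply/negP => /andP[eZ eS].
    by have /andP[_ /implyP/(_ eZ)] := H e (subsetP Zs _ eZ); rewrite eS.
  elim: (s) => [|e s' IH] /=; first by rewrite big_nil.
  by rewrite big_cons -IH -natrM mulnb.
rewrite bexp_prod //.
rewrite (eq_bigr (fun e => (if e \in F then p else 1) * (if e \in Z then 1 - p else 1))).
  rewrite big_split /= -(@big_rmcond_in _ _ _ _ s (mem F)) /=; last first.
    by move=> e _ /negbTE ->.
  rewrite -(@big_rmcond_in _ _ _ _ s (mem Z)) /=; last by move=> e _ /negbTE ->.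
  have half (D : {set E}) (a : R) : D \subset s ->
      \prod_(e <- s | e \in D) (if e \in D then a else 1) = a ^+ #|D|.
    move=> /subsetP Ds; rewrite (eq_bigr (fun=> a)) => [|e ->//].
    rewrite -big_filter (perm_big (enum D)) ?big_enum ?prodr_const //=.
    apply: uniq_perm => [||e]; [exact: filter_uniq|exact: enum_uniq|].
    by rewrite mem_filter mem_enum andb_idr //; apply: Ds.
  by rewrite !half.
move=> e _; rewrite /g; case: (boolP (e \in F)) => eF; case: (boolP (e \in Z)) => eZ.
- by move: FZ => /pred0P/(_ e); rewrite /= eF eZ.
- by rewrite /=; ring.
- by rewrite /=; ring.
- by rewrite /=; ring.
Qed.

(** The bridge from the recursive expectation to the explicit product measure of [Gnp_weight]. The
    sum is split according to whether the head of [s] belongs to [S]. *)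
Lemma bexp_sets s (f : {set E} -> R) : uniq s ->
  \sum_(S : {set E} | S \subset s) (\prod_(e <- s) (if e \in S then p else 1 - p)) * f S
  = bexp s f.
Proof.
elim: s f => [|e s IH] f /=.
  rewrite (big_pred1 set0) => [|S]; first by rewrite big_nil mul1r.
  apply/subsetP/eqP => [S0|-> x]; last by rewrite inE.
  by apply/setP => x; rewrite inE; apply/negP => /S0.
case/andP=> es us; rewrite -!IH // !big_distrr /= (bigID (fun S : {set E} => e \in S)) /=.
have eNS (S : {set E}) : S \subset s -> e \notin S.
  by move=> /subsetP Ss; apply: contra es; apply: Ss.
have sub (S : {set E}) : (e |: S \subset e :: s) = (S \subset e :: s).
  apply/subsetP/subsetP => H x xS; first by apply: H; rewrite inE xS orbT.
  by move: xS; rewrite !inE => /orP[->//|/H]; rewrite inE.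
have subN (S : {set E}) : e \notin S -> (S \subset e :: s) = (S \subset s).
  move=> eS; apply/subsetP/subsetP => H x xS; last by rewrite inE H ?orbT.
  by have := H x xS; rewrite inE => /orP[/eqP xe|//]; rewrite -xe xS in eS.
congr (_ + _).
  rewrite (reindex_onto (fun S : {set E} => e |: S) (fun S => S :\ e)) /=; last first.
    by move=> S /andP[_ eS]; rewrite setD1K.
  apply: eq_big => S.
    rewrite sub !inE eqxx /= andbT; apply/andP/idP => [[Ss /eqP <-]|Ss].
      by apply/subsetP => x; rewrite !inE => /andP[xe /orP[/eqP xe'|/(subsetP Ss)]];
        [rewrite xe' eqxx in xe | rewrite inE (negbTE xe)].
    by rewrite subN ?eNS // setU1K ?eNS.
  case/andP=> _ _; rewrite big_cons !inE eqxx mulrA /=; congr (_ * _ * _).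
  apply: eq_big_seq => x xs; rewrite !inE; case: eqP => // xe.
  by rewrite -xe xs in es.
apply: eq_big => S.
  apply/andP/idP => [[Ss eS]|Ss]; first by rewrite -subN.
  by rewrite subN ?eNS.
case/andP=> _ eS; rewrite big_cons (negbTE eS) mulrA; congr (_ * _ * _).
by apply/f_equal/setP => x; rewrite !inE; case: eqP => // ->; apply/negbTE.
Qed.

Hypotheses (p0 : 0 <= p) (p1 : p <= 1).

Lemma le_bexp s f g : (forall S, f S <= g S) -> bexp s f <= bexp s g.
Proof.
elim: s f g => [|e s IH] f g fg /=; first exact: fg.
by apply: lerD; apply: ler_wpM2l; rewrite ?subr_ge0 //; apply: IH => S; apply: fg.
Qed.

Lemma bexp_ge0 s f : (forall S, 0 <= f S) -> 0 <= bexp s f.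
Proof. by move=> f0; rewrite -[leLHS](bexp_cst s); apply: le_bexp. Qed.

(** Union bound. *)
Lemma bexp_exists (I : finType) (P : pred I) s (A : I -> pred {set E}) :
  bexp s (fun S => [exists (i | P i), A i S]%:R)
  <= \sum_(i | P i) bexp s (fun S => (A i S)%:R).
Proof.
rewrite -bexp_sum; apply: le_bexp => S.
case: existsP => [[i /andP[Pi Ai]]|_]; last by apply: sumr_ge0.
by rewrite (bigD1 i) //= Ai lerDl sumr_ge0.
Qed.

End RandomSubset.

Lemma Gnp_prob_bexp (R : realFieldType) (n : nat) (p : R) (A : pred {set {set 'I_n}}) :
  Gnp_prob p (fun G : sgraph 'I_n => A (edges G))
  = bexp p (enum (pairs 'I_n)) (fun S => (A S)%:R).
Proof.
rewrite -bexp_sets ?enum_uniq // (reindex_omap (@edges 'I_n) insub) => [|J JP]; last first.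
  by rewrite insubT //; apply/subsetP => e /(subsetP JP); rewrite mem_enum.
rewrite /Gnp_prob big_mkcond /=; apply: eq_big => [[E EP]|[E EP] _] /=.
  rewrite insubT /= eqxx andbT; apply/esym/subsetP => e eE.
  by rewrite mem_enum (subsetP EP).
by rewrite /Gnp_weight big_enum /=; case: (A E); rewrite ?mulr1 ?mulr0.
Qed.

Lemma sum_subsets_exp (R : comNzRingType) (T : finType) (D : {set T}) (x : R) :
  \sum_(S : {set T} | S \subset D) x ^+ #|S| = (1 + x) ^+ #|D|.
Proof.
transitivity (\prod_(i : T) ((if i \in D then x else 0) + 1)); last first.
  rewrite -prodr_const [RHS]big_mkcond /=; apply: eq_bigr => i _.
  by case: ifP => _; rewrite ?add0r // addrC.
rewrite bigA_distr /= big_mkcond /=; apply: eq_bigr => S _.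
case: ifPn => [/subsetP SD|/subsetPn[i iS iD]].
  rewrite -prodr_const big_mkcond /=; apply: eq_bigr => i _.
  by case: ifP => // /SD ->.
by rewrite (bigD1 i) //= iS (negbTE iD) mul0r.
Qed.

(** * The bipartition number and partitions into stars *)

Lemma tau_le (T : finType) (G : sgraph T) (P : {set {set {set T}}}) :
  biclique_partition G P -> (tau G <= #|P|)%N.
Proof.
move=> GP; rewrite /tau; case: ex_minnP => m _; apply.
by apply/existsP; exists P; rewrite GP eqxx.
Qed.

Lemma tauP (T : finType) (G : sgraph T) :
  exists P : {set {set {set T}}}, biclique_partition G P /\ #|P| = tau G.
Proof.
by rewrite /tau; case: ex_minnP => m /existsP[P /andP[GP /eqP <-]] _; exists P.
Qed.

(* The star at a vertex [v] outside [I] collects the edges whose first vertex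
   outside [I] is [v]. *)
Lemma tau_independent (T : finType) (G : sgraph T) (I : {set T}) :
  (forall e : {set T}, e \in edges G -> ~~ (e \subset I)) -> (tau G + #|I| <= #|T|)%N.
Proof.
move=> indI; pose center (e : {set T}) := ohead [seq v <- enum T | v \in e :\: I].
pose star v := [set e in edges G | center e == Some v].
have centerP e : e \in edges G -> exists2 v, center e = Some v & v \in e :\: I.
  move=> /indI /subsetPn[x xe xI].
  rewrite /center; case E : [seq _ <- _ | _] => [|v r] /=.
    have : x \in [::] by rewrite -E mem_filter inE xI xe mem_enum.
    by rewrite in_nil.
  by exists v => //; have := mem_head v r; rewrite -E mem_filter => /andP[].
pose P := preim_partition center (edges G).
have PP : partition P (edges G) := preim_partitionP _ _.
have Pstar B : B \in P -> exists2 v, v \notin I & B = star v /\ B != set0.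
  case/imsetP => e eG ->; have [v ev] := centerP e eG; rewrite inE => /andP[vI _].
  exists v => //; split; last by apply/set0Pn; exists e; rewrite inE eG /=.
  by apply/setP => f; rewrite !inE ev eq_sym.
have -> : #|T| = (#|~: I| + #|I|)%N by rewrite addnC cardsC.
rewrite leq_add2r; apply: (@leq_trans #|P|).
  apply: tau_le; rewrite /biclique_partition PP; apply/forall_inP => B /Pstar[v vI [-> sv0]].
  have inY y : ([set v; y] \in star v) -> y != v.
    rewrite inE => /andP[/(subsetP (edges_pairs G))]; rewrite inE cards2 [y == v]eq_sym.
    by case: (v == y).
  have starE e : e \in star v -> exists2 y, e = [set v; y] & y != v.
    rewrite inE => /andP[eG /eqP ev]; have [w] := centerP e eG; rewrite ev => -[<-].
    rewrite inE => /andP[_ ve]; have := subsetP (edges_pairs G) e eG.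
    rewrite inE => /cards2P[a [b [ab eE]]]; move: ve; rewrite eE !inE => /orP[]/eqP->.
      by exists b => //; rewrite eq_sym.
    by exists a => //; rewrite setUC.
  apply/existsP; exists [set v]; apply/existsP; exists [set y | [set v; y] \in star v].
  apply/and4P; split.
  - by apply/set0Pn; exists v; rewrite inE.
  - case/set0Pn: sv0 => e es; have [y ey yv] := starE e es.
    by apply/set0Pn; exists y; rewrite inE -ey.
  - by rewrite disjoints1 inE; apply/negP => /inY; rewrite eqxx.
  - apply/eqP/setP => e; apply/idP/imset2P => [es|[x y]].
      have [y ey yv] := starE e es; exists v y; rewrite ?inE ?eqxx //.
      by move: es; rewrite ey inE.
    by rewrite inE => /eqP -> ys ->; rewrite inE in ys.
apply: (@leq_trans #|star @: ~: I|); last exact: leq_imset_card.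
by apply/subset_leq_card/subsetP => B /Pstar[v vI [-> _]]; apply: imset_f; rewrite inE.
Qed.

(** * Reduction to bicliques that are not stars *)

Definition fiber (T : finType) (B : {set T * T}) (i : T) : {set T} := [set u | (i, u) \in B].

(* The bicliques are [fiber B i] x [fiber Y i], smaller side first. Since there are at
   most [#|W|] of them, the vertices [i] of [W] serve as indices; a vertex that indexes
   no biclique has an empty fiber. *)
Record starless_cover (T : finType) (E : {set {set T}}) (W : {set T})
    (B Y : {set T * T}) : Prop := StarlessCover {
  cover_subl : B \subset setX W W;
  cover_subr : Y \subset setX W W;
  cover_all : forall e, e \in E -> e \subset W ->
    exists i u v, [/\ (i, u) \in B, (i, v) \in Y & e = [set u; v]];
  cover_edge : forall i u v, (i, u) \in B -> (i, v) \in Y -> u != v /\ [set u; v] \in E;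
  cover_inj : forall i j u v, (i, u) \in B -> (i, v) \in Y ->
    (j, u) \in B -> (j, v) \in Y -> i = j;
  cover_size : forall i u, (i, u) \in B -> (1 < #|fiber B i| <= #|fiber Y i|)%N
}.

Lemma exists_starless_cover (T : finType) (G : sgraph T) (P : {set {set {set T}}}) (k : nat) :
  biclique_partition G P -> (#|P| + k <= #|T|)%N ->
  exists (W : {set T}) (B Y : {set T * T}), (k <= #|W|)%N /\ starless_cover (edges G) W B Y.
Proof.
case/andP=> PG /forall_inP bicP Pk.
pose act (W : {set T}) := [set B in P | [exists e in B, e \subset W]].
pose meas (W : {set T}) := ((#|act W| + #|~: W|) * #|T|.+1 + #|W|)%N.
(* Minimise the number of bicliques with an edge inside [W] minus [#|W|], then [#|W|]:
   a star centred at [x] would die together with [x], against minimality. *)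
case: (@arg_minnP _ [set: T] predT meas isT) => W _ Wmin.
have PN0 B : B \in P -> B != set0.
  by move=> BP; apply: contraTneq BP => ->; case/and3P: PG.
have actT : (#|act setT| <= #|P|)%N.
  by apply/subset_leq_card/subsetP => B; rewrite inE => /andP[].
(* The factor [#|T|.+1] in [meas] exceeds every [#|W|], so the first component at [W] is at most
   that at [[set: T]]. *)
have kW : (#|act W| + k <= #|W|)%N.
  have := Wmin setT isT; rewrite /meas setCT cards0 cardsT addn0 => H.
  have := cardsC W; have := max_card W; nia.
have shrink B x : B \in act W -> x \in W -> exists2 e, e \in B & e \subset W :\ x.
  move=> BW xW; apply/exists_inP; apply: contraT => /exists_inPn noe.
  have sub : act (W :\ x) \subset act W :\ B.
    apply/subsetP => B'; rewrite !inE => /andP[BP /existsP[e /andP[eB eW]]].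
    rewrite BP /= andbC; apply/andP; split.
      by apply/existsP; exists e; rewrite eB (subset_trans eW) // subsetDl.
    by apply/eqP => BB; have := noe e; rewrite -BB eB eW => /(_ isT).
  have := subset_leq_card sub; have := cardsD1 B (act W); rewrite BW => aW aW'.
  have := Wmin (W :\ x) isT; rewrite /meas.
  have := cardsC W; have := cardsC (W :\ x); have := cardsD1 x W; rewrite xW; nia.
pose good (B : {set {set T}}) (Q : {set T} * {set T}) :=
  [&& (1 < #|Q.1| <= #|Q.2|)%N, [disjoint Q.1 & Q.2], Q.1 \subset W, Q.2 \subset W,
    cross Q.1 Q.2 \subset B & [forall e in B, (e \subset W) ==> (e \in cross Q.1 Q.2)]].
(* One vertex of [X] lies in [W]; an edge that survives its deletion supplies a second one. *)
have goodC B X Y : B \in act W -> X != set0 -> Y != set0 ->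
    [disjoint X & Y] -> B = cross X Y -> (1 < #|X :&: W|)%N.
  move=> BW X0 Y0 XY BE.
  have [x xXW] : exists x, x \in X :&: W.
    move: BW; rewrite inE => /andP[_ /exists_inP[e]]; rewrite BE => /imset2P[x y xX yY ->].
    by rewrite subUset !sub1set => /andP[xW _]; exists x; rewrite inE xX.
  rewrite (cardsD1 x) xXW ltnS card_gt0; apply/set0Pn.
  have [|e] := shrink B x BW; first by case/setIP: xXW.
  rewrite BE => /imset2P[a b aX bY ->]; rewrite subUset !sub1set => /andP[/setD1P[ax aW] _].
  by exists a; rewrite !inE ax aX.
have crossC X Y : cross X Y = cross Y X :> {set {set T}}.
  by apply/setP => e; apply/imset2P/imset2P => -[a b aX bY ->]; exists b a; rewrite // setUC.
have exgood B : B \in act W -> {Q | good B Q}.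
  move=> BW; apply: sigW; have /bicP/existsP[X /existsP[Y]] : B \in P by case/setIdP: BW.
  case/and4P=> X0 Y0 XY /eqP BE.
  have X2 := goodC _ _ _ BW X0 Y0 XY BE.
  have Y2 : (1 < #|Y :&: W|)%N.
    by apply: (goodC _ _ _ BW Y0 X0); rewrite 1?disjoint_sym // crossC.
  have gen X' Y' : B = cross X' Y' -> [disjoint X' & Y'] -> (1 < #|X' :&: W|)%N ->
      (#|X' :&: W| <= #|Y' :&: W|)%N -> good B (X' :&: W, Y' :&: W).
    move=> BE' XY' c1 c2; apply/and5P; split; rewrite /= ?c1 ?c2 ?subsetIr //.
      by apply: disjointWl (subsetIl _ _) _; apply: disjointWr (subsetIl _ _) _.
    apply/andP; split.
      apply/subsetP => e /imset2P[a b /setIP[aX _] /setIP[bY _] ->].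
      by rewrite BE'; apply/imset2P; exists a b.
    apply/forall_inP => e; rewrite BE' => /imset2P[a b aX bY ->].
    apply/implyP; rewrite subUset !sub1set => /andP[aW bW].
    by apply/imset2P; exists a b; rewrite ?inE ?aX ?bY.
  have [le|/ltnW le] := leqP #|X :&: W| #|Y :&: W|.
    by exists (X :&: W, Y :&: W); apply: gen.
  by exists (Y :&: W, X :&: W); apply: gen; rewrite 1?disjoint_sym // crossC.
pose side B := if [pick Q | good B Q] is Some Q then Q else (set0, set0).
have sideP B : B \in act W -> good B (side B).
  by move=> /exgood[Q gQ]; rewrite /side; case: pickP => // /(_ Q); rewrite gQ.
(* The active bicliques are listed along [W], which is long enough by [kW]. Positions past the end
   give [set0], which is never active because a partition has no empty member. *)
pose blk i := nth set0 (enum (act W)) (index i (enum W)).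
have blk_inj i j : blk i \in act W -> i \in W -> blk i = blk j -> j \in W -> i = j.
  move=> ia iW ij jW; have sz x : blk x \in act W -> (index x (enum W) < size (enum (act W)))%N.
    rewrite ltnNge => xa; apply/negP => le; move: xa; rewrite /blk nth_default //.
    by move=> /setIdP[/PN0]; rewrite eqxx.
  have ja : blk j \in act W by rewrite -ij.
  move/eqP: ij; rewrite /blk nth_uniq ?enum_uniq ?sz // => /eqP ij.
  by apply: (index_inj i (s := enum W)); rewrite ?mem_enum.
pose B0 := [set z in setX W W | (blk z.1 \in act W) && (z.2 \in (side (blk z.1)).1)].
pose Y0 := [set z in setX W W | (blk z.1 \in act W) && (z.2 \in (side (blk z.1)).2)].
have B0P i u : (i, u) \in B0 -> [/\ i \in W, blk i \in act W & u \in (side (blk i)).1].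
  by rewrite !inE /= => /andP[/andP[iW _] /andP[ia us]]; split; rewrite // inE.
have Y0P i u : (i, u) \in Y0 -> [/\ i \in W, blk i \in act W & u \in (side (blk i)).2].
  by rewrite !inE /= => /andP[/andP[iW _] /andP[ia us]]; split; rewrite // inE.
have edgeB i u v : (i, u) \in B0 -> (i, v) \in Y0 -> [set u; v] \in blk i.
  case/B0P=> _ ia uA /Y0P[_ _ vY]; have /and5P[_ _ _ _ /andP[/subsetP sub _]] := sideP _ ia.
  by apply: sub; apply/imset2P; exists u v.
exists W, B0, Y0; split; first by lia.
split.
- by apply/subsetP => z /setIdP[].
- by apply/subsetP => z /setIdP[].
- move=> e eG eW; have : e \in cover P by rewrite (cover_partition PG).
  case/bigcupP=> B BP eB; have BW : B \in act W.
    by rewrite inE BP; apply/exists_inP; exists e.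
  have [i iW iB] : exists2 i, i \in W & blk i = B.
    have lt : (index B (enum (act W)) < size (enum W))%N.
      have := BW; rewrite -mem_enum -index_mem -!cardE => lt.
      by apply: leq_trans lt _; lia.
    have x0 : T by case: (enum W) lt.
    exists (nth x0 (enum W) (index B (enum (act W)))); first by rewrite -mem_enum mem_nth.
    by rewrite /blk index_uniq ?enum_uniq // nth_index ?mem_enum.
  have /and5P[_ _ /subsetP sW1 /subsetP sW2 /andP[_ /forall_inP/(_ e eB)/implyP/(_ eW)]] := sideP _ BW.
  case/imset2P=> u v us vs ->; exists i, u, v.
  by rewrite !inE /= iW iB sW1 // sW2 // us vs; move: BW; rewrite inE => ->.
- move=> i u v iu iv; have uvB := edgeB _ _ _ iu iv.
  have [_ ia uA] := B0P _ _ iu; have [_ _ vY] := Y0P _ _ iv.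
  have /and5P[_ dis _ _ _] := sideP _ ia; split.
    by apply: contraTneq vY => <-; rewrite (disjointFr dis uA).
  have iP : blk i \in P by case/setIdP: ia.
  by rewrite -(cover_partition PG); apply/bigcupP; exists (blk i).
- move=> i j u v iu iv ju jv.
  have [iW ia _] := B0P _ _ iu; have [jW ja _] := B0P _ _ ju.
  apply: blk_inj => //; apply/eqP; apply: contraT => ij.
  have /and3P[_ /trivIsetP tr _] := PG.
  have := tr (blk i) (blk j); rewrite ij; case/setIdP: ia => -> _; case/setIdP: ja => -> _.
  by move=> /(_ isT isT isT)/disjointFr/(_ (edgeB _ _ _ iu iv)); rewrite edgeB.
- move=> i u iu; have [iW ia _] := B0P _ _ iu.
  have /and5P[c _ /subsetP sW1 /subsetP sW2 _] := sideP _ ia.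
  have -> : fiber B0 i = (side (blk i)).1.
    apply/setP => x; rewrite !inE /= iW; move: ia; rewrite inE => -> /=.
    by rewrite andb_idl //; apply: sW1.
  have -> // : fiber Y0 i = (side (blk i)).2.
  apply/setP => x; rewrite !inE /= iW; move: ia; rewrite inE => -> /=.
  by rewrite andb_idl //; apply: sW2.
Qed.

Lemma set2_inj (T : finType) (a b c d : T) :
  [set a; b] = [set c; d] -> (a = c /\ b = d) \/ (a = d /\ b = c).
Proof.
move=> E; have : a \in [set c; d] by rewrite -E set21.
have : b \in [set c; d] by rewrite -E set22.
have : c \in [set a; b] by rewrite E set21.
have : d \in [set a; b] by rewrite E set22.
by rewrite !inE => /orP[]/eqP hd /orP[]/eqP hc /orP[]/eqP hb /orP[]/eqP ha; subst; auto.
Qed.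

Lemma leq_card_bigcup (I T : finType) (P : pred I) (F : I -> {set T}) :
  (#|\bigcup_(i | P i) F i| <= \sum_(i | P i) #|F i|)%N.
Proof.
elim/big_rec2: _ => [|i m A _ le]; first by rewrite cards0.
by rewrite cardsU (leq_trans (leq_subr _ _)) // leq_add2l.
Qed.

(** * Pairs that no ordinary biclique can cover *)

Section UncoveredPairs.
Variables (T : finType) (W : {set T}) (B : {set T * T}) (K D : nat).
Hypothesis BW : B \subset setX W W.

(* A block is the smaller side [fiber B i] of a biclique. If an ordinary biclique covers
   the edge [uv] from a block containing [u], then [v] is adjacent to the whole block:
   this necessary condition, [ord_covered], does not involve the other sides. *)
Definition hubs : {set T} :=
  [set u in W | (D < #|[set i | ((i, u) \in B) && (#|fiber B i| <= K)]|)%N].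

Definition ordinary (i : T) : bool :=
  (1 < #|fiber B i| <= K)%N && [disjoint fiber B i & hubs].

Definition ord_covered (S : {set {set T}}) (u v : T) : bool :=
  [exists i, [&& ordinary i, u \in fiber B i, v \notin fiber B i
    & [forall w in fiber B i, [set w; v] \in S]]].

Definition uncovered (S : {set {set T}}) : {set T * T} :=
  [set z in setX W W | [&& z.1 != z.2, [set z.1; z.2] \in S,
     ~~ ord_covered S z.1 z.2 & ~~ ord_covered S z.2 z.1]].

Lemma fiber_index i u : (i, u) \in B -> (i \in W) && (u \in W).
Proof. by move/(subsetP BW); rewrite inE. Qed.

Lemma card_fibers (C : {set T * T}) : C \subset setX W W ->
  #|C| = (\sum_(i in W) #|fiber C i|)%N.
Proof.
move=> /subsetP CW; rewrite -sum1_card (partition_big (fun z => z.1) (mem W)) /=; last first.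
  by move=> z /CW; rewrite inE => /andP[].
apply: eq_bigr => i iW; rewrite -sum1_card.
rewrite (reindex_onto (fun u => (i, u)) (fun z => z.2)) /=; last first.
  by case=> j u /= /andP[_ /eqP ->].
by apply: eq_bigl => u; rewrite inE !eqxx !andbT.
Qed.

(** Double counting of incidences: there are at most [#|W|] blocks, those counted have at most [K]
    vertices, and each hub lies in more than [D] of them. *)
Lemma card_hubs : (D.+1 * #|hubs| <= K * #|W|)%N.
Proof.
rewrite mulnC -sum_nat_const.
apply: (@leq_trans (\sum_(u in W) #|[set i | ((i, u) \in B) && (#|fiber B i| <= K)]|)%N).
  rewrite [leqRHS](bigID (fun u => u \in hubs)) /=; apply: leq_trans (leq_addr _ _).
  rewrite [leqRHS](eq_bigl (mem hubs)) => [|u]; last first.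
    by rewrite andb_idl // => /setIdP[].
  by apply: leq_sum => u; rewrite inE => /andP[].
under eq_bigr do rewrite -sum1_card.
rewrite (exchange_big_dep (mem W)) /=; last first.
  by move=> u i _; rewrite inE => /andP[/fiber_index/andP[]].
rewrite mulnC -sum_nat_const; apply: leq_sum => i iW; rewrite sum1_card.
have [aK|aK] := leqP #|fiber B i| K.
  apply: leq_trans aK; apply/subset_leq_card/subsetP => u.
  by rewrite unfold_in !inE => /andP[_ /andP[]].
rewrite eq_card0 // => u; rewrite unfold_in !inE andbA; apply/negP => /andP[_].
by rewrite leqNgt aK.
Qed.

(** By [cover_inj], an ordered pair of vertices of [W] lies in at most one product of [fiber B i]
    and [fiber Y i]. *)
Lemma sum_blocks_le (Y : {set T * T}) (E : {set {set T}}) :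
  starless_cover E W B Y -> (\sum_(i in W) #|fiber B i| * #|fiber Y i| <= #|W| ^ 2)%N.
Proof.
move=> cov; have [_ /subsetP YW _ _ inj _] := cov.
pose Q (z : T * T) i := (z.1 \in fiber B i) && (z.2 \in fiber Y i).
apply: (@leq_trans (\sum_(z in setX W W) #|[set i in W | Q z i]|)%N); last first.
  apply: (@leq_trans (\sum_(z in setX W W) 1)%N); last by rewrite sum1_card cardsX mulnn.
  apply: leq_sum => z _; apply/card_le1_eqP => i j.
  rewrite !inE => /andP[_ /andP[iB iY]] /andP[_ /andP[jB jY]].
  by move: jB jY iB iY; rewrite !inE; apply: inj.
rewrite [leqRHS](eq_bigr (fun z => \sum_(i in [set i in W | Q z i]) 1)%N) => [|z _]; last first.
  by rewrite sum1_card.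
rewrite (exchange_big_dep (mem W)) /=; last by move=> z i _; rewrite inE => /andP[].
apply: leq_sum => i iW; rewrite -cardsX sum1_card; apply/subset_leq_card/subsetP => -[u v].
rewrite inE /= => /andP[]; rewrite !inE => uB vY; rewrite unfold_in /= !inE iW /= /Q !inE uB vY /=.
have /andP[_ ->] := fiber_index uB.
by have := YW _ vY; rewrite inE => /andP[_ ->].
Qed.

(** A block of size b satisfies 2kb <= k^2 + b^2, and b^2 is at most the product of the two sides,
    which [sum_blocks_le] sums. So [B] is sparse in [setX W W], which keeps the union bound over [B]
    cheap. *)
Lemma card_cover_left (Y : {set T * T}) (E : {set {set T}}) (k : nat) :
  starless_cover E W B Y -> (k ^ 2 <= #|W|)%N -> (k * #|B| <= #|W| ^ 2)%N.
Proof.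
move=> cov kW; have := sum_blocks_le cov; have [_ _ _ _ _ size] := cov => le.
rewrite card_fibers // -(leq_pmul2l (m := 2)) // mulnA big_distrr /=.
apply: (@leq_trans (\sum_(i in W) (k ^ 2 + #|fiber B i| * #|fiber Y i|))%N).
  apply: leq_sum => i iW; have [->|[u]] := set_0Vmem (fiber B i).
    by rewrite cards0 muln0.
  rewrite inE => /size/andP[_ h]; rewrite -mulnA (leq_trans (nat_Cauchy _ _)) // leq_add2l.
  by rewrite -mulnn leq_mul2l h orbT.
rewrite big_split /= sum_nat_const mul2n -addnn -[X in (_ <= X + _)%N]mulnn.
by apply: leq_add => //; rewrite leq_mul2l kW orbT.
Qed.

(* Since the bicliques are edge-disjoint, each vertex lies on the other side of few
   bicliques with more than [K] vertices in their block. *)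
Definition coarse_part (Y : {set T * T}) : {set T * T} :=
  [set z in Y | (K < #|fiber B z.1|)%N].

(** The set [C] is a free variable, so that a union bound can run over all sparse [C] instead of all
    [Y]. *)
Definition coarse_edges (C : {set T * T}) : {set {set T}} :=
  [set [set z.1.2; z.2.2] | z in [set z | [&& z.1 \in B, z.2 \in C & z.1.1 == z.2.1]]].

Lemma card_coarse_part (Y : {set T * T}) (E : {set {set T}}) :
  starless_cover E W B Y -> (K * #|coarse_part Y| <= #|W| ^ 2)%N.
Proof.
move=> cov; apply: leq_trans (sum_blocks_le cov); have [_ YW _ _ _ _] := cov.
have CW : coarse_part Y \subset setX W W.
  by apply: subset_trans YW; apply/subsetP => z; rewrite inE => /andP[].
rewrite card_fibers // big_distrr /=; apply: leq_sum => i iW.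
have [->|[u]] := set_0Vmem (fiber (coarse_part Y) i); first by rewrite cards0 muln0.
rewrite !inE /= => /andP[_ Ki]; apply: leq_mul; first exact: ltnW.
by apply/subset_leq_card/subsetP => v; rewrite !inE => /andP[].
Qed.

Lemma coarse_edges_sub (Y : {set T * T}) (E : {set {set T}}) :
  starless_cover E W B Y -> coarse_edges (coarse_part Y) \subset E.
Proof.
case=> _ _ _ edge _ _; apply/subsetP => e /imsetP[[[i u] [j v]]].
rewrite !inE /= => /and3P[uB /andP[vY _] /eqP ij] ->.
by rewrite -ij in vY; have [] := edge _ _ _ uB vY.
Qed.

Definition hub_pairs (Y : {set T * T}) : {set T * T} :=
  [set z | [exists i, [&& (#|fiber B i| <= K)%N, ~~ [disjoint fiber B i & hubs],
     (i, z.1) \in B & (i, z.2) \in Y]]].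

(** A hub [h] in the block and a vertex [v] on the other side determine the biclique, because it
    covers the edge [hv]; so each choice of [v] and [h] accounts for at most [K] pairs. *)
Lemma card_hub_pairs (Y : {set T * T}) (E : {set {set T}}) :
  starless_cover E W B Y -> (#|hub_pairs Y| <= #|W| * (#|hubs| * K))%N.
Proof.
case=> _ /subsetP YW _ _ inj _.
pose N (v h : T) := [set u | [exists i, [&& (#|fiber B i| <= K)%N, (i, h) \in B,
   (i, u) \in B & (i, v) \in Y]]].
have NK v h : (#|N v h| <= K)%N.
  have [->|[u]] := set_0Vmem (N v h); first by rewrite cards0.
  rewrite inE => /existsP[i /and4P[iK ih _ iv]].
  apply: leq_trans iK; apply/subset_leq_card/subsetP => w.
  rewrite !inE => /existsP[j /and4P[_ jh jw jv]].
  by rewrite (inj _ _ _ _ ih iv jh jv).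
apply: (@leq_trans #|\bigcup_(v in W) \bigcup_(h in hubs) [set (u, v) | u in N v h]|).
  apply/subset_leq_card/subsetP => -[u v]; rewrite inE => /existsP[i /and4P[iK]].
  rewrite -setI_eq0 => /set0Pn[h /setIP[]]; rewrite inE => ih hh iu iv.
  apply/bigcupP; exists v; first by have := YW _ iv; rewrite inE => /andP[].
  apply/bigcupP; exists h => //; apply: imset_f; rewrite inE.
  by apply/existsP; exists i; rewrite iK ih iu iv.
apply: leq_trans (leq_card_bigcup _ _) _.
rewrite -sum_nat_const; apply: leq_sum => v _.
apply: leq_trans (leq_card_bigcup _ _) _.
rewrite -sum_nat_const; apply: leq_sum => h _.
exact: leq_trans (leq_imset_card _ _) (NK v h).
Qed.

Lemma card_ordered_pairs (F : {set {set T}}) :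
  (#|[set z : T * T | (z.1 != z.2) && ([set z.1; z.2] \in F)]| <= 2 * #|F|)%N.
Proof.
rewrite -sum1_card (partition_big (fun z => [set z.1; z.2]) (mem F)) /=; last first.
  by move=> z; rewrite inE => /andP[].
rewrite mulnC -sum_nat_const; apply: leq_sum => e _.
rewrite sum1_card; set Q := fun _ => _.
have [z|Q0] := pickP Q; last by rewrite eq_card0.
case: z => a b; rewrite /Q inE /= => /andP[/andP[ab _] /eqP eE].
apply: (@leq_trans #|[set (a, b); (b, a)]|); last by rewrite cards2; case: eqP.
apply/subset_leq_card/subsetP => -[x y] Qxy.
have {Qxy} : Q (x, y) by []; rewrite /Q inE /= => /andP[/andP[xy _] /eqP].
rewrite -eE !inE => /set2_inj[[-> ->]|[-> ->]]; rewrite eqxx ?orbT //.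
Qed.

(** An edge inside [W] lies in some biclique. An ordinary one would make it [ord_covered] from one
    end, so for an uncovered edge the block is larger than [K] or meets the hubs. The factors 2
    count the two orders of a pair. *)
Lemma card_uncovered (Y : {set T * T}) (E : {set {set T}}) :
  starless_cover E W B Y ->
  (#|uncovered E| <= 2 * #|coarse_edges (coarse_part Y)| + 2 * (#|W| * (#|hubs| * K)))%N.
Proof.
move=> cov; have HP := card_hub_pairs cov; have [_ _ all edge _ size] := cov.
set CE := coarse_edges _; set HPs := hub_pairs Y in HP.
pose P1 := [set z : T * T | (z.1 != z.2) && ([set z.1; z.2] \in CE)].
pose swap (z : T * T) := (z.2, z.1).
apply: (@leq_trans #|P1 :|: (HPs :|: [set swap z | z in HPs])|); last first.
  apply: leq_trans (leq_card_setU _ _).1 _; apply: leq_add; first exact: card_ordered_pairs.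
  apply: leq_trans (leq_card_setU _ _).1 _; rewrite mul2n -addnn; apply: leq_add => //.
  exact: leq_trans (leq_imset_card _ _) HP.
apply/subset_leq_card/subsetP => -[u v]; rewrite inE /= in_setX /=.
case/andP=> /andP[uW vW] /and4P[uv uvE nuv nvu].
rewrite !in_setU [_ \in P1]inE /=.
have [|i [a [b [ia ib eE]]]] := all _ uvE; first by rewrite subUset !sub1set uW.
have main x y : (i, x) \in B -> (i, y) \in Y -> ~~ ord_covered E x y ->
    ([set x; y] \in CE) || ((x, y) \in HPs).
  move=> ix iy nxy; have [Ki|iK] := ltnP K #|fiber B i|.
    apply/orP; left; apply/imsetP; exists ((i, x), (i, y)) => //.
    by rewrite !inE /= ix iy Ki eqxx.
  apply/orP; right; rewrite inE /=; apply/existsP; exists i; rewrite iK ix iy /= andbT.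
  apply: contra nxy => dis; apply/existsP; exists i.
  have /andP[i2 _] := size _ _ ix; rewrite /ordinary i2 iK dis inE ix /=.
  apply/andP; split; last by apply/forall_inP => w; rewrite inE => iw; have [] := edge _ _ _ iw iy.
  by apply/negP; rewrite inE => iyB; have [] := edge _ _ _ iyB iy; rewrite eqxx.
have [[ua vb]|[ub va]] := set2_inj eE.
- rewrite -ua -vb in ia ib; have /orP[->|->] := main _ _ ia ib nuv; first by rewrite uv.
  by rewrite orbT.
- rewrite -ub -va in ia ib; have /orP[h|h] := main _ _ ia ib nvu.
    by rewrite uv setUC h.
  by rewrite (imset_f swap h) !orbT.
Qed.

Definition mates (x : T) : {set T} :=
  [set u | [exists i, [&& ordinary i, x \in fiber B i & u \in fiber B i]]].

Lemma card_mates x : (#|mates x| <= D * K)%N.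
Proof.
have [->|[w]] := set_0Vmem (mates x); first by rewrite cards0.
rewrite inE => /existsP[j /and3P[/andP[_ dj] xj _]].
have xW : x \in W by move: xj; rewrite inE => /fiber_index/andP[].
have : x \notin hubs by rewrite (disjointFr dj xj).
rewrite inE xW /= -leqNgt; set I := [set _ | _] => ID.
apply: (@leq_trans #|\bigcup_(i in I) fiber B i|).
  apply/subset_leq_card/subsetP => u; rewrite inE => /existsP[i /and3P[/andP[/andP[_ iK] _] xi ui]].
  by apply/bigcupP; exists i => //; rewrite inE iK andbT; rewrite inE in xi.
apply: leq_trans (leq_card_bigcup _ _) _.
apply: (@leq_trans (\sum_(i in I) K)%N); last by rewrite sum_nat_const leq_mul2r ID orbT.
by apply: leq_sum => i; rewrite inE => /andP[].
Qed.

Lemma mates_sym x u : (u \in mates x) = (x \in mates u).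
Proof.
by rewrite !inE; apply/existsP/existsP => -[i /and3P[? ? ?]]; exists i; apply/and3P.
Qed.

Lemma mates_sub x u : u \in mates x -> (u \in W) && (x \in W).
Proof.
rewrite inE => /existsP[i /and3P[_ xi ui]]; move: xi ui; rewrite !inE.
by move=> /fiber_index/andP[_ ->] /fiber_index/andP[_ ->].
Qed.

(** The ordered pairs whose membership in [uncovered] can depend on the presence of [e]. *)
Definition influenced (e : {set T}) : {set T * T} :=
  [set z | [|| [set z.1; z.2] == e, [exists w in mates z.1, [set w; z.2] == e]
     | [exists w in mates z.2, [set w; z.1] == e]]].

Lemma card_influenced e : (#|influenced e| <= 2 + 4 * (D * K))%N.
Proof.
have [/existsP[x /existsP[y /eqP eE]]|none] :=
    boolP [exists x, exists y, e == [set x; y]]; last first.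
  rewrite eq_card0 // => -[u v]; rewrite inE /=.
  have no x y : ([set x; y] == e) = false.
    apply: contraNF none => /eqP <-.
    by apply/existsP; exists x; apply/existsP; exists y.
  by rewrite no /=; apply/norP; split; apply/exists_inPn => w _; rewrite no.
have mXY a b : (#|setX (mates a) [set b]| <= D * K)%N.
  by rewrite cardsX cards1 muln1 card_mates.
have mYX a b : (#|setX [set b] (mates a)| <= D * K)%N.
  by rewrite cardsX cards1 mul1n card_mates.
apply: (@leq_trans #|[set (x, y); (y, x)] :|: ((setX (mates x) [set y] :|: setX (mates y) [set x])
   :|: (setX [set y] (mates x) :|: setX [set x] (mates y)))|).
  apply/subset_leq_card/subsetP => -[u v]; rewrite inE /= eE.
  rewrite !in_setU !in_setX /= !inE !xpair_eqE -!/(mates _).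
  case/or3P=> [/eqP/set2_inj[[-> ->]|[-> ->]]|/exists_inP[w mw /eqP]|/exists_inP[w mw /eqP]].
  - by rewrite !eqxx.
  - by rewrite !eqxx orbT.
  - by rewrite mates_sym in mw => /set2_inj[[ww ->]|[ww ->]];
      rewrite ww inE in mw; rewrite mw eqxx ?orbT.
  - by rewrite mates_sym in mw => /set2_inj[[ww ->]|[ww ->]];
      rewrite ww inE in mw; rewrite mw eqxx ?orbT.
apply: leq_trans (leq_card_setU _ _).1 _; apply: leq_add.
  by rewrite cards2; case: eqP.
rewrite (_ : 4 * _ = (D * K + D * K) + (D * K + D * K))%N; last by lia.
apply: leq_trans (leq_card_setU _ _).1 _; apply: leq_add.
  by apply: leq_trans (leq_card_setU _ _).1 _; apply: leq_add.
by apply: leq_trans (leq_card_setU _ _).1 _; apply: leq_add.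
Qed.

(** The bounded difference constant. Whether [(u, v)] is uncovered depends only on [uv] and on pairs
    joining one end to a mate of the other; these all lie in [W], so an [e] not inside [W] has no
    effect. *)
Lemma uncovered_lipschitz (S S' : {set {set T}}) (e : {set T}) :
  {in predC1 e, S =i S'} ->
  (#|uncovered S| <= #|uncovered S'| + (if e \subset W then 2 + 4 * (D * K) else 0))%N.
Proof.
move=> SS'.
have cov_change u v : u \in W -> v \in W -> ~~ ord_covered S u v -> ord_covered S' u v ->
    (e \subset W) && [exists w in mates u, [set w; v] == e].
  move=> uW vW nc /existsP[i /and4P[oi ui vi /forall_inP all]].
  have [w wi wS] : exists2 w, w \in fiber B i & [set w; v] \notin S.
    apply/exists_inP; apply: contraR nc; rewrite negb_exists => /forallP no.
    apply/existsP; exists i; rewrite oi ui vi; apply/forall_inP => w wi.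
    by have := no w; rewrite wi /= negbK.
  have ew : [set w; v] = e.
    apply/eqP; apply: contraR wS => we; rewrite SS' ?inE //; exact: all.
  have wu : w \in mates u by rewrite inE; apply/existsP; exists i; rewrite oi ui.
  apply/andP; split; last by apply/exists_inP; exists w; rewrite ?ew.
  by rewrite -ew subUset !sub1set vW andbT; case/andP: (mates_sub wu).
have key z : z \in uncovered S -> z \notin uncovered S' ->
    (e \subset W) && (z \in influenced e).
  case: z => u v; rewrite inE /= in_setX /= => /andP[/andP[uW vW] /and4P[uv uvS cuv cvu]].
  rewrite inE /= in_setX /= uW vW uv /= 2!negb_and !negbK => /or3P[uvS'|cuv'|cvu'].
  - have ee : [set u; v] = e.
      by apply/eqP; apply: contraR uvS' => we; rewrite -SS' ?inE.
    by rewrite inE /= ee eqxx -ee subUset !sub1set uW vW.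
  - by have /andP[-> h] := cov_change _ _ uW vW cuv cuv'; rewrite inE /= h orbT.
  - by have /andP[-> h] := cov_change _ _ vW uW cvu cvu'; rewrite inE /= h !orbT.
case: ifP => eW.
  apply: leq_trans (leq_add (leqnn _) (card_influenced e)).
  apply: leq_trans (leq_card_setU _ _).1; apply/subset_leq_card/subsetP => z zS.
  rewrite inE; case: (boolP (z \in uncovered S')) => //= zS'.
  by have /andP[] := key z zS zS'.
rewrite addn0; apply/subset_leq_card/subsetP => z zS; apply: contraT => zS'.
by have := key z zS zS'; rewrite eW.
Qed.

End UncoveredPairs.

(** * The expected number of uncovered pairs *)

(** At [p = 1/2] the terms decrease from [a = 9] on, where the value is 9/256. *)
Lemma natr_mul_exp_half (R : realFieldType) (p : R) (a : nat) :
  0 <= p -> p <= 1 / 2 -> (8 < a)%N -> a%:R * p ^+ a.-1 <= 9 / 256.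
Proof.
move=> p0 p2 a8; pose b := (a - 9)%N; have -> : a = (b + 9)%N by rewrite /b; lia.
have h : (b + 9)%:R * (1 / 2) ^+ (b + 8) <= 9 / 256 :> R.
  elim: b => [|b IH]; first by rewrite !add0n; lra.
  apply: le_trans IH; rewrite !addSn exprS mulrA ler_wpM2r ?exprn_ge0 ?divr_ge0 //.
  by rewrite -natr1; have : 0 <= b%:R :> R by []; rewrite !natrD; lra.
apply: le_trans h; rewrite addnS /= ler_wpM2l // lerXn2r ?nnegrE //; lra.
Qed.

Section ExpectedUncovered.
Variables (R : realFieldType) (p : R) (T : finType) (W : {set T}) (B : {set T * T}) (K D : nat).
Hypotheses (p0 : 0 < p) (p2 : p <= 1 / 2) (BW : B \subset setX W W).

Notation P := (bexp p (enum (pairs T))).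
Notation ordinary := (ordinary W B K D).
Notation uncovered := (uncovered W B K D).

Local Fact p_ge0 : 0 <= p. Proof. exact: ltW. Qed.
Local Fact p_le1 : p <= 1. Proof. by move: p2; lra. Qed.
Local Fact q_ge0 : 0 <= 1 - p. Proof. by rewrite subr_ge0 p_le1. Qed.
Local Hint Resolve p_ge0 p_le1 q_ge0 : core.

Lemma cylinder_le (F Z : {set {set T}}) : F \subset pairs T -> Z \subset pairs T ->
  P (fun S => ((F \subset S) && [disjoint Z & S])%:R) <= p ^+ #|F| * (1 - p) ^+ #|Z|.
Proof.
move=> FP ZP; have [dis|ndis] := boolP [disjoint F & Z].
  rewrite bexp_cylinder ?enum_uniq //; apply/subsetP => x; rewrite mem_enum.
    exact: (subsetP FP).
  exact: (subsetP ZP).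
rewrite (@eq_bexp _ _ _ _ _ (fun=> 0)) ?bexp_cst ?mulr_ge0 ?exprn_ge0 //.
move=> S; rewrite (_ : _ && _ = false) //; apply: contraNF ndis => /andP[FS ZS].
by rewrite disjoint_sym; apply: disjointWr FS ZS.
Qed.

(* Blocks of at most 8 vertices are blocked by forbidding all their edges to [v]; for
   the wider ones a union bound suffices, because [a p^(a-1)] is small for [a > 8]. The
   resulting bound does not depend on [K] and [D]. *)
Definition fine_blocks (u : T) : {set T} :=
  [set i | [&& ordinary i, (#|fiber B i| <= 8)%N & u \in fiber B i]].

Definition wide_blocks (u : T) : {set T} :=
  [set i | [&& ordinary i, (8 < #|fiber B i|)%N & u \in fiber B i]].

Definition wide_weight (u : T) : R := \sum_(i in wide_blocks u) p ^+ #|fiber B i|.-1.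

Definition star_from (v : T) (A : {set T}) : {set {set T}} := [set [set w; v] | w in A].

(** Edges whose absence keeps every fine block of [u] from covering the pair; [u] is left out of the
    blocks because [uv] itself has to be an edge. *)
Definition witnesses (u v : T) : {set {set T}} :=
  \bigcup_(i in fine_blocks u | v \notin fiber B i) star_from v (fiber B i :\ u).

Lemma star_from_pairs v (A : {set T}) : v \notin A -> star_from v A \subset pairs T.
Proof.
move=> vA; apply/subsetP => e /imsetP[w wA ->]; rewrite inE cards2.
by case: (eqVneq w v) => // wv; rewrite -wv wA in vA.
Qed.

Lemma witnesses_pairs u v : witnesses u v \subset pairs T.
Proof.
apply/bigcupsP => i /andP[_ vi]; apply: star_from_pairs.
by rewrite !inE negb_and; apply/orP; right; rewrite inE in vi.
Qed.

Lemma card_witnesses u v : (#|witnesses u v| <= 7 * #|fine_blocks u|)%N.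
Proof.
apply: leq_trans (leq_card_bigcup _ _) _; rewrite mulnC -sum_nat_const.
rewrite big_mkcondr /=; apply: leq_sum => i; rewrite inE => /and3P[_ i8 ui].
case: ifP => // _; apply: leq_trans (leq_imset_card _ _) _.
by move: i8; rewrite (cardsD1 u) ui.
Qed.

Lemma card_star_from v (A : {set T}) : #|star_from v A| = #|A|.
Proof.
apply: card_in_imset => a b _ _ /set2_inj[[//]|[-> ->]] //.
Qed.

(* The exponent is [448 = 2 * 7 * 32], the largest number of forbidden edges. *)
Lemma prob_uncovered u v : u != v -> u \in W -> v \in W ->
  (#|fine_blocks u| <= 32)%N -> (#|fine_blocks v| <= 32)%N ->
  wide_weight u <= 1 / 7 -> wide_weight v <= 1 / 7 ->
  p * (1 - p) ^+ 448 * (5 / 7) <= P (fun S => ((u, v) \in uncovered S)%:R).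
Proof.
move=> uv uW vW u32 v32 ru rv.
pose Z := witnesses u v :|: witnesses v u.
have ZP : Z \subset pairs T by rewrite subUset !witnesses_pairs.
have Z448 : (#|Z| <= 448)%N.
  apply: leq_trans (leq_card_setU _ _).1 _.
  by have := card_witnesses u v; have := card_witnesses v u; lia.
pose C y i (S : {set {set T}}) : R :=
  ((star_from y (fiber B i) \subset S) && [disjoint Z & S])%:R.
pose Q x y (S : {set {set T}}) : R :=
  \sum_(i in wide_blocks x | y \notin fiber B i) C y i S.
have Q0 x y S : 0 <= Q x y S by apply: sumr_ge0.
(* With [Z] absent only wide blocks can cover, and [Q] counts those joined completely to [y]. *)
have uncov_part x y (S : {set {set T}}) : x != y -> [disjoint Z & S] -> witnesses x y \subset Z ->
    ord_covered W B K D S x y -> 1 <= Q x y S.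
  move=> xy dis wZ /existsP[i /and4P[oi xi yi /forall_inP all]].
  have [i8|i8] := leqP #|fiber B i| 8; last first.
    rewrite /Q (bigD1 i) /=; last by rewrite inE oi i8 xi.
    rewrite {1}/C dis andbT (_ : _ \subset S = true) ?lerDl ?sumr_ge0 //.
    by apply/subsetP => e /imsetP[w wi ->]; apply: all.
  have : (0 < #|fiber B i :\ x|)%N.
    by have /andP[/andP[+ _] _] := oi; rewrite (cardsD1 x) xi.
  case/card_gt0P => w wi; have wyS := all w; have : [set w; y] \in Z.
    apply: (subsetP wZ); apply/bigcupP; exists i; first by rewrite inE oi i8 xi.
    exact: imset_f.
  by move=> /(disjointFr dis); rewrite all //; case/setD1P: wi.
have pointwise (S : {set {set T}}) : (([set [set u; v]] \subset S) && [disjoint Z & S])%:R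
    <= ((u, v) \in uncovered S)%:R + (Q u v S + Q v u S).
  case: (boolP (_ && _)) => [/andP[uvS dis]|_]; last by rewrite !addr_ge0.
  rewrite inE /= in_setX /= uW vW uv -sub1set uvS /=.
  have [cuv|ncuv] /= := boolP (ord_covered _ _ _ _ S u v).
    have := uncov_part u v S uv dis (subsetUl _ _) cuv; have := Q0 v u S; lra.
  have [cvu|ncvu] /= := boolP (ord_covered _ _ _ _ S v u).
    rewrite eq_sym in uv.
    have := uncov_part v u S uv dis (subsetUr _ _) cvu; have := Q0 u v S; lra.
  by rewrite lerDl addr_ge0.
(* The star from [y] to a wide block of [x] contains the edge [xy]; taking out its factor [p] leaves
   the exponent of [wide_weight]. *)
have PQ x y : P (Q x y) <= p * (1 - p) ^+ #|Z| * wide_weight x.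
  rewrite bexp_sum /wide_weight mulr_sumr big_mkcondr /=.
  apply: ler_sum => i; rewrite inE => /and3P[_ _ xi]; case: ifPn => yi; last first.
    by rewrite !mulr_ge0 ?exprn_ge0.
  apply: le_trans (cylinder_le (star_from_pairs yi) ZP) _.
  have a0 : (0 < #|fiber B i|)%N by rewrite (cardD1 x) xi.
  by rewrite card_star_from -{1}(prednK a0) exprS mulrAC.
have F1 : P (fun S => (([set [set u; v]] \subset S) && [disjoint Z & S])%:R)
    = p * (1 - p) ^+ #|Z|.
  rewrite bexp_cylinder ?enum_uniq ?cards1 ?expr1 //.
  - by apply/subsetP => e; rewrite mem_enum inE => /eqP ->; rewrite inE cards2 uv.
  - by apply/subsetP => e; rewrite mem_enum; apply: (subsetP ZP).
  rewrite disjoints1; apply/negP; case/setUP=> /bigcupP[i /andP[_ _]] /imsetP[w].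
    case/setD1P=> wu _ /set2_inj[[uw _]|[uv' _]]; first by rewrite uw eqxx in wu.
    by rewrite uv' eqxx in uv.
  case/setD1P=> wv _ /set2_inj[[_ vu]|[_ vw]]; first by rewrite vu eqxx in uv.
  by rewrite vw eqxx in wv.
(* The two wide weights cost at most 2/7 of [p * (1 - p) ^+ #|Z|], hence the factor 5/7. *)
have := le_bexp p_ge0 p_le1 (enum (pairs T)) pointwise.
rewrite F1 !bexpD => H; have := PQ u v; have := PQ v u.
have : (1 - p) ^+ 448 <= (1 - p) ^+ #|Z|.
  by apply: ler_wiXn2l => //; rewrite lerBlDr lerDl.
have : 0 <= p * (1 - p) ^+ #|Z| by rewrite mulr_ge0 ?exprn_ge0.
set X := P (fun _ => _) in H *; set q := (1 - p) ^+ #|Z| in H *.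
set r := (1 - p) ^+ 448; set Qu := P _ in H *; set Qv := P _ in H *.
move=> pq0 rq Qv' Qu'.
have : p * q * wide_weight u <= p * q * (1 / 7) by apply: ler_wpM2l.
have : p * q * wide_weight v <= p * q * (1 / 7) by apply: ler_wpM2l.
have : p * r <= p * q by apply: ler_wpM2l.
move: H Qv' Qu'; clearbody r q X Qu Qv; clear; lra.
Qed.

Lemma sum_blocks_at (f : T -> R) (A : pred T) :
  (forall i, A i -> (i \in W) && (fiber B i \subset W)) ->
  \sum_(u in W) \sum_(i | A i && (u \in fiber B i)) f i = \sum_(i | A i) #|fiber B i|%:R * f i.
Proof.
move=> AW; rewrite (exchange_big_dep A) /= => [|u i _ /andP[]//].
apply: eq_bigr => i Ai; rewrite (eq_bigl (mem (fiber B i))) => [|u].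
  by rewrite mulr_natl; apply: sumr_const.
rewrite Ai /= andb_idl //; have /andP[_ /subsetP h] := AW i Ai; exact: h.
Qed.

Definition typical : {set T} :=
  [set u in W | (#|fine_blocks u| <= 32)%N && (wide_weight u <= 1 / 7)].

(** Markov's inequality: on average a vertex lies in at most 8 fine blocks and has wide weight at
    most 9/256, so the atypical proportion is at most 8/33 + 7 * 9/256 < 1/2. *)
Lemma card_typical : (#|W| <= 2 * #|typical|)%N.
Proof.
have ordW i : ordinary i -> (i \in W) && (fiber B i \subset W).
  case/andP=> /andP[i1 _] _.
  have [x xi] : exists x, x \in fiber B i by apply/card_gt0P; apply: leq_trans i1.
  move: xi; rewrite inE => /(fiber_index BW)/andP[-> _].
  by apply/subsetP => y; rewrite inE => /(fiber_index BW)/andP[].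
have fine : \sum_(u in W) #|fine_blocks u|%:R <= 8 * #|W|%:R :> R.
  rewrite (eq_bigr (fun u => \sum_(i | (ordinary i && (#|fiber B i| <= 8)%N) && (u \in fiber B i)) 1)); last first.
    move=> u _; rewrite -sum1_card natr_sum; apply: eq_bigl => i; by rewrite inE andbA.
  rewrite sum_blocks_at => [|i /andP[/ordW]//].
  apply: (@le_trans _ _ (\sum_(i in W) 8)); last by rewrite sumr_const mulr_natr.
  rewrite big_mkcond [leRHS]big_mkcond /=; apply: ler_sum => i _.
  case: ifP => [/andP[/ordW/andP[-> _] i8]|_]; last by case: ifP.
  by rewrite mulr1 ler_nat.
have wide : \sum_(u in W) wide_weight u <= 9 / 256 * #|W|%:R.
  rewrite (eq_bigr (fun u => \sum_(i | (ordinary i && (8 < #|fiber B i|)%N) && (u \in fiber B i))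
    p ^+ #|fiber B i|.-1)); last first.
    by move=> u _; apply: eq_bigl => i; rewrite inE andbA.
  rewrite sum_blocks_at => [|i /andP[/ordW]//].
  apply: (@le_trans _ _ (\sum_(i in W) (9 / 256))); last by rewrite sumr_const mulr_natr.
  rewrite big_mkcond [leRHS]big_mkcond /=; apply: ler_sum => i _.
  case: ifP => [/andP[/ordW/andP[-> _] i8]|_]; last by case: ifP => //; lra.
  exact: natr_mul_exp_half.
have bad : #|W :\: typical|%:R <= \sum_(u in W) (#|fine_blocks u|%:R / 33 + 7 * wide_weight u).
  rewrite -sum1_card natr_sum [leRHS](big_setID typical) /=.
  have w0 u : 0 <= wide_weight u by apply: sumr_ge0 => i _; rewrite exprn_ge0.
  rewrite -[leLHS]add0r; apply: lerD.
    by apply: sumr_ge0 => u _; rewrite addr_ge0 ?divr_ge0 // mulr_ge0.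
  apply: ler_sum => u; rewrite !inE => /andP[+ uW]; rewrite uW /= negb_and -ltnNge -ltNge.
  have wu := w0 u; case/orP=> [|h].
    by rewrite -(ler_nat R) => h; lra.
  by have : 0 <= #|fine_blocks u|%:R :> R by []; lra.
rewrite big_split /= -mulr_suml -mulr_sumr in bad.
have := cardsID typical W; rewrite (setIidPr _); last by apply/subsetP => u; rewrite inE => /andP[].
move/(congr1 (fun n : nat => n%:R : R)); rewrite natrD -(ler_nat R) natrM => E.
have : 0 <= #|W|%:R :> R by []; lra.
Qed.

Lemma expected_uncovered : (4 <= #|W|)%N ->
  p * (1 - p) ^+ 448 / 16 * #|W|%:R ^+ 2 <= P (fun S => #|uncovered S|%:R).
Proof.
move=> W4; have gW := card_typical; set g := #|typical| in gW.
(* At least half of [W] is typical and [4 <= #|W|], so [Q] has at least [#|W| ^ 2 / 8] elements;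
   then 5/7 * 1/8 exceeds the 1/16 of the statement. *)
pose Q := [set z in setX typical typical | z.1 != z.2].
have QE : (g * g <= #|Q| + g)%N.
  rewrite -cardsX; apply: (@leq_trans #|Q :|: [set (x, x) | x in typical]|).
    apply/subset_leq_card/subsetP => -[x y]; rewrite in_setX => /andP[xt yt].
    rewrite in_setU [_ \in Q]inE in_setX /=.
    by rewrite xt yt /=; case: eqP => //= <-; apply: imset_f.
  apply: leq_trans (leq_card_setU _ _).1 _; rewrite leq_add2l; exact: leq_imset_card.
have Q8 : (#|W| ^ 2 <= 8 * #|Q|)%N by rewrite -mulnn; nia.
have -> : P (fun S => #|uncovered S|%:R) = \sum_z P (fun S => (z \in uncovered S)%:R).
  rewrite -bexp_sum; apply: eq_bexp => S.
  by rewrite -sum1_card natr_sum big_mkcond /=; apply: eq_bigr => z _; case: ifP.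
apply: (@le_trans _ _ (\sum_(z in Q) (p * (1 - p) ^+ 448 * (5 / 7)))); last first.
  rewrite big_mkcond /=; apply: ler_sum => -[u v] _; case: ifP => [|_].
    rewrite inE in_setX /= !inE => /andP[/andP[/and3P[uW u1 u2] /and3P[vW v1 v2]] uv].
    exact: prob_uncovered.
  exact: bexp_ge0.
rewrite sumr_const -[leRHS]mulr_natr; set c := p * _.
have c0 : 0 <= c by rewrite mulr_ge0 ?exprn_ge0.
move: Q8; rewrite -(ler_nat R) natrX natrM => Q8.
have := ler_wpM2l c0 Q8; have : 0 <= c * #|Q|%:R by rewrite mulr_ge0.
rewrite /c.
by move: ((1 - p) ^+ 448) (#|W|%:R ^+ 2) (#|Q|%:R) => r m2 n; lra.
Qed.

End ExpectedUncovered.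

(** * Independent sets, by the second moment method *)

Section IndependentSets.
Variables (R : realFieldType) (p : R) (T : finType).
Hypotheses (p0 : 0 <= p) (p1 : p < 1).
Notation P := (bexp p (enum (pairs T))).
Notation n := #|T|.

Definition inner_pairs (I : {set T}) : {set {set T}} := [set e in pairs T | e \subset I].

Lemma card_inner_pairs (I : {set T}) : #|inner_pairs I| = 'C(#|I|, 2).
Proof.
by rewrite -cards_draws; apply: eq_card => e; rewrite !inE andbC.
Qed.

Lemma inner_pairsI (I J : {set T}) : inner_pairs I :&: inner_pairs J = inner_pairs (I :&: J).
Proof. by apply/setP => e; rewrite !inE subsetI; case: (_ == _). Qed.

Lemma tau_indep_set (G : sgraph T) (I : {set T}) :
  [disjoint inner_pairs I & edges G] -> (tau G + #|I| <= n)%N.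
Proof.
move=> dis; apply: tau_independent => e eG; apply/negP => eI.
have : e \in inner_pairs I by rewrite inE eI andbT; apply: (subsetP (edges_pairs G)).
by move/(disjointFr dis); rewrite eG.
Qed.

(** The ratio of the binomials is the product of the (s - i) / (n - i) for i < l, each at most s /
    n. *)
Lemma bin_sub_le (l s : nat) : (l <= s <= n)%N ->
  ('C(n - l, s - l) * n ^ l <= 'C(n, s) * s ^ l)%N.
Proof.
case/andP=> + sn; elim: l => [|l IH] ls; first by rewrite !subn0.
have {}IH := IH (ltnW ls); rewrite !expnSr !mulnA.
have nl : (0 < n - l)%N by rewrite subn_gt0 (leq_trans ls).
have E := mul_bin_diag (n - l) (s - l.+1).
have sE : (s - l.+1).+1 = (s - l)%N by rewrite subnSK.
have nE : (n - l).-1 = (n - l.+1)%N by rewrite subnS.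
rewrite sE nE in E.
have key : ((s - l) * n <= (n - l) * s)%N.
  by rewrite !mulnBl [(n * s)%N]mulnC leq_sub2l // leq_mul2l sn orbT.
apply: (@leq_trans ('C(n - l, s - l) * s * n ^ l)); last by rewrite mulnAC leq_mul2r IH orbT.
rewrite mulnAC leq_mul2r -(leq_pmul2l nl) !mulnA E mulnAC [X in (_ <= X)%N]mulnAC.
by rewrite leq_mul2r key !orbT.
Qed.

Lemma card_supersets (L : {set T}) (s : nat) :
  (#|[set J : {set T} | L \subset J & #|J| == s]| <= 'C(n - #|L|, s - #|L|))%N.
Proof.
have -> : (n - #|L| = #|~: L|)%N by rewrite [RHS]cardsCs setCK.
rewrite -cards_draws.
rewrite -(@card_in_imset _ _ (fun J : {set T} => J :\: L)) => [|J J']; last first.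
  rewrite !inE => /andP[LJ _] /andP[LJ' _] E.
  by rewrite -(setID J L) -(setID J' L) E (setIidPr LJ) (setIidPr LJ').
apply/subset_leq_card/subsetP => A /imsetP[J]; rewrite !inE => /andP[LJ /eqP <-] ->.
by rewrite cardsD (setIidPr LJ) eqxx andbT setDE subsetIr.
Qed.

(** The overlap sum of the second moment: [b] will be the inverse of the non-edge probability, and
    [x] stands in for the square root of [b ^+ s.-1]. *)
Lemma sum_overlaps (I : {set T}) (s : nat) (b x : R) :
  #|I| = s -> (0 < s)%N -> 1 <= b -> 0 <= x -> b ^+ s.-1 <= x ^+ 2 ->
  \sum_(J : {set T} | #|J| == s) b ^+ 'C(#|I :&: J|, 2)
  <= 'C(n, s)%:R * (1 + x * s%:R / n%:R) ^+ s.
Proof.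
move=> Is s0 b1 x0 bx; have sn : (s <= n)%N by rewrite -Is max_card.
have b0 : 0 <= b by apply: le_trans b1.
have n0 : 0 < n%:R :> R by rewrite ltr0n (leq_trans s0).
(* Twice the binomial is l (l - 1), so squaring both sides reduces this to the assumption on [x]. *)
have bl l : (l <= s)%N -> b ^+ 'C(l, 2) <= x ^+ l.
  move=> ls; rewrite -(@ler_pXn2r _ 2) ?nnegrE ?exprn_ge0 // -!exprM.
  rewrite mulnC -(mul_bin_diag l 1) bin1 mulnC exprM [X in _ <= x ^+ X]mulnC exprM.
  rewrite lerXn2r ?nnegrE ?exprn_ge0 //; apply: le_trans bx.
  by rewrite ler_weXn2l // -!subn1 leq_sub2r.
(* Only the term [L = I :&: J] of the inner sum is needed; summing over all common
   subsets [L] makes the sum over [J] a count of supersets. *)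
apply: (@le_trans _ _ (\sum_(J : {set T} | #|J| == s) \sum_(L : {set T} | L \subset I)
    (if L \subset J then x ^+ #|L| else 0))).
  apply: ler_sum => J Js; rewrite (bigD1 (I :&: J)) ?subsetIl //= subsetIr.
  apply: (@le_trans _ _ (x ^+ #|I :&: J|)).
    by apply: bl; rewrite -Is subset_leq_card // subsetIl.
  by rewrite lerDl; apply: sumr_ge0 => L _; case: ifP => // _; rewrite exprn_ge0.
rewrite exchange_big /= -Is -sum_subsets_exp mulr_sumr; apply: ler_sum => L LI.
have Ls : (#|L| <= s)%N by rewrite -Is subset_leq_card.
rewrite -big_mkcondr /= (eq_bigl (mem [set J : {set T} | L \subset J & #|J| == #|I|])) => [|J]; last first.
  by rewrite /= inE andbC.
rewrite sumr_const Is -[leLHS]mulr_natl.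
apply: (@le_trans _ _ ('C(n - #|L|, s - #|L|)%:R * x ^+ #|L|)).
  by rewrite ler_wpM2r ?exprn_ge0 // ler_nat card_supersets.
rewrite [leRHS](_ : _ = 'C(n, s)%:R * s%:R ^+ #|L| * x ^+ #|L| / n%:R ^+ #|L|); last first.
  by rewrite !exprMn exprVn; ring.
rewrite ler_pdivlMr ?exprn_gt0 // mulrAC ler_wpM2r ?exprn_ge0 // -!natrX -!natrM ler_nat.
by apply: bin_sub_le; rewrite Ls.
Qed.

(** Chebyshev's inequality: with [X] the number of independent [s]-sets and [mu] its mean, the
    indicator of [X = 0] is at most [(1 - X / mu) ^+ 2], whose expectation is E X^2 / mu^2 - 1. *)
Lemma no_independent_set_le (s : nat) (x : R) : (0 < s <= n)%N -> 0 <= x ->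
  (1 - p)^-1 ^+ s.-1 <= x ^+ 2 ->
  P (fun S => [forall (I : {set T} | #|I| == s), ~~ [disjoint inner_pairs I & S]]%:R)
  <= (1 + x * s%:R / n%:R) ^+ s - 1.
Proof.
case/andP=> s0 sn x0 bx; pose q := 1 - p.
have q0 : 0 < q by rewrite subr_gt0.
have p1' : p <= 1 := ltW p1.
have indepP (F : {set {set T}}) : F \subset pairs T -> P (fun S => [disjoint F & S]%:R) = q ^+ #|F|.
  move=> FP.
  have sF : F \subset enum (pairs T).
    by apply/subsetP => e /(subsetP FP); rewrite mem_enum.
  have s0F : set0 \subset enum (pairs T) by apply/subsetP => e; rewrite inE.
  have dF : [disjoint set0 & F] by rewrite -setI_eq0 set0I.
  have := bexp_cylinder p (enum_uniq _) s0F sF dF; rewrite cards0 expr0 mul1r => <-.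
  by apply: eq_bexp => S; rewrite sub0set.
have innerP I : inner_pairs I \subset pairs T by apply/subsetP => e /setIdP[].
pose X (S : {set {set T}}) : R := \sum_(I : {set T} | #|I| == s) [disjoint inner_pairs I & S]%:R.
pose mu : R := 'C(n, s)%:R * q ^+ 'C(s, 2).
have mu_gt0 : 0 < mu by rewrite mulr_gt0 ?exprn_gt0 // ltr0n bin_gt0.
have card_s : #|[pred I : {set T} | #|I| == s]| = 'C(n, s).
  by rewrite -cardsT -cards_draws; apply: eq_card => I; rewrite !inE subsetT.
have EX : P X = mu.
  rewrite bexp_sum (eq_bigr (fun=> q ^+ 'C(s, 2))) => [|I /eqP Is].
    by rewrite sumr_const card_s -[LHS]mulr_natl.
  by rewrite indepP // card_inner_pairs Is.
have EX2 : P (fun S => X S * X S) <= mu ^+ 2 * (1 + x * s%:R / n%:R) ^+ s.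
  rewrite (@eq_bexp _ _ _ _ _ (fun S => \sum_(I : {set T} | #|I| == s) \sum_(J : {set T} | #|J| == s)
      [disjoint inner_pairs I :|: inner_pairs J & S]%:R)); last first.
    move=> S; rewrite /X mulr_suml; apply: eq_bigr => I _; rewrite mulr_sumr; apply: eq_bigr => J _.
    by rewrite -natrM mulnb -!setI_eq0 setIUl setU_eq0.
  rewrite bexp_sum (eq_bigr (fun I : {set T} => \sum_(J : {set T} | #|J| == s)
      q ^+ ('C(s, 2) + 'C(s, 2)) * q^-1 ^+ 'C(#|I :&: J|, 2))); last first.
    move=> I /eqP Is; rewrite bexp_sum; apply: eq_bigr => J /eqP Js.
    rewrite indepP ?subUset ?innerP // cardsU inner_pairsI !card_inner_pairs Is Js.
    rewrite exprVn exprB ?unitfE ?lt0r_neq0 // (leq_trans _ (leq_addr _ _)) //.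
    by rewrite leq_bin2l // -Is subset_leq_card // subsetIl.
  apply: (@le_trans _ _ (\sum_(I : {set T} | #|I| == s) (q ^+ ('C(s, 2) + 'C(s, 2))
     * ('C(n, s)%:R * (1 + x * s%:R / n%:R) ^+ s)))).
    apply: ler_sum => I /eqP Is; rewrite -mulr_sumr ler_wpM2l ?exprn_ge0 ?(ltW q0) //.
    by apply: sum_overlaps => //; rewrite invf_ge1 // lerBlDr lerDl.
  by rewrite sumr_const card_s -[leLHS]mulr_natl /mu exprD le_eqVlt; apply/orP; left; apply/eqP; ring.
have le (S : {set {set T}}) : [forall (I : {set T} | #|I| == s), ~~ [disjoint inner_pairs I & S]]%:R
    <= mu^-1 ^+ 2 * (X S * X S) + (1 + (- 2 * mu^-1) * X S).
  have -> : mu^-1 ^+ 2 * (X S * X S) + (1 + (- 2 * mu^-1) * X S) = (1 - mu^-1 * X S) ^+ 2 by ring.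
  case: forall_inP => [H|_]; last exact: sqr_ge0.
  rewrite /X big1 ?mulr0 ?subr0 ?expr1n // => I Is; by rewrite (negbTE (H I Is)).
apply: le_trans (le_bexp p0 p1' _ le) _.
rewrite bexpD bexpZ bexpD bexp_cst bexpZ EX.
have -> : 1 + - 2 * mu^-1 * mu = - 1 by rewrite -mulrA mulVf ?gt_eqF //; ring.
by rewrite lerD2r exprVn ler_pdivrMl ?exprn_gt0.
Qed.

End IndependentSets.

(** * Transfer to G(n,p) *)

Lemma Gnp_prob_le (R : realFieldType) (n : nat) (p : R) (A : pred (sgraph 'I_n))
    (A' : pred {set {set 'I_n}}) :
  0 <= p -> p <= 1 -> (forall G, A G -> A' (edges G)) ->
  Gnp_prob p A <= bexp p (enum (pairs 'I_n)) (fun S => (A' S)%:R).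
Proof.
move=> p0 p1 AA'; rewrite -Gnp_prob_bexp /Gnp_prob [leLHS]big_mkcond [leRHS]big_mkcond /=.
apply: ler_sum => G _; have w0 : 0 <= Gnp_weight p G.
  by apply: prodr_ge0 => e _; case: ifP; rewrite ?subr_ge0.
by case: ifPn => [/AA' ->//|_]; case: ifP.
Qed.

Lemma Gnp_prob_union (R : realFieldType) (n : nat) (p : R) (A F1 F2 : pred (sgraph 'I_n)) :
  0 <= p -> p <= 1 -> (forall G, [|| A G, F1 G | F2 G]) ->
  `|1 - Gnp_prob p A| <= Gnp_prob p F1 + Gnp_prob p F2.
Proof.
move=> p0 p1 cov; have w0 (G : sgraph 'I_n) : 0 <= Gnp_weight p G.
  by apply: prodr_ge0 => e _; case: ifP; rewrite ?subr_ge0.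
rewrite -(Gnp_probT n p) /Gnp_prob /= (bigID A) /= addrAC subrr add0r.
rewrite ger0_norm ?sumr_ge0 // [leLHS]big_mkcond /= !(big_mkcond F1) !(big_mkcond F2) /= -big_split /=.
apply: ler_sum => G _; have := cov G; have := w0 G.
by case: (A G) => /=; case: (F1 G); case: (F2 G) => //=; rewrite ?addr0 ?add0r ?lerDl ?addr_ge0.
Qed.

Lemma tau_upper_prob (R : realFieldType) (n : nat) (p : R) (s : nat) (x : R) :
  0 <= p -> p < 1 -> (0 < s <= n)%N -> 0 <= x -> (1 - p)^-1 ^+ s.-1 <= x ^+ 2 ->
  Gnp_prob p (fun G : sgraph 'I_n => ~~ (tau G + s <= n)%N) <= (1 + x * s%:R / n%:R) ^+ s - 1.
Proof.
move=> p0 p1 sn x0 bx; have := @no_independent_set_le R p 'I_n p0 p1 s x.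
rewrite card_ord => /(_ sn x0 bx); apply: le_trans.
apply: Gnp_prob_le => // [|G tG]; first exact: ltW.
apply/forall_inP => I /eqP Is; apply: contra tG => /tau_indep_set.
by rewrite Is card_ord.
Qed.

From mathcomp Require Import all_classical all_reals all_analysis.
From mathcomp Require Import fintype finset.

Import numFieldNormedType.Exports.

(** * Concentration and counting *)

Section Concentration.
Variables (R : realType) (E : finType) (p : R).
Hypotheses (p0 : 0 <= p) (p1 : p <= 1).

Lemma expR_le_quad (x : R) : `|x| <= 1 / 3 -> expR x <= 1 + x + x ^+ 2.
Proof.
rewrite ler_norml => /andP[x1 x2].
suff : 1 <= (1 + x + x ^+ 2) * expR (- x).
  by rewrite expRN -ler_pdivrMr ?invr_gt0 ?expR_gt0 // invrK mul1r.
(* For [x <= 0] the bound exp(-x) >= 1 - x is enough; for positive [x] it is applied to [x / 2] and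
   squared. *)
have [x0|x0] := leP x 0; first by have := expR_ge1Dx (- x); nra.
have -> : expR (- x) = expR (- (x / 2)) ^+ 2.
  by rewrite -expRM_natl; congr expR; field.
have h := expR_ge1Dx (- (x / 2)).
have {}h : (1 - x / 2) ^+ 2 <= expR (- (x / 2)) ^+ 2.
  by rewrite lerXn2r ?nnegrE ?expR_ge0 //; lra.
apply: (@le_trans _ _ ((1 + x + x ^+ 2) * (1 - x / 2) ^+ 2)); last by apply: ler_wpM2l => //; nra.
have -> : (1 + x + x ^+ 2) * (1 - x / 2) ^+ 2 = 1 + x ^+ 2 * (1 - 3 * x + x ^+ 2) / 4 by field.
rewrite lerDl mulr_ge0 ?invr_ge0 // mulr_ge0 ?sqr_ge0 //.
have := sqr_ge0 x; lra.
Qed.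

(** After centring at the mean [m], the linear terms of [expR_le_quad] cancel and the quadratic ones
    add up to p (1 - p) t^2 with t = l (x - y). *)
Lemma bernoulli_mgf (x y l c : R) : `|x - y| <= c -> 0 <= l -> l * c <= 1 / 3 ->
  p * expR (- l * x) + (1 - p) * expR (- l * y)
  <= expR (- l * (p * x + (1 - p) * y) + l ^+ 2 * c ^+ 2).
Proof.
move=> xyc l0 lc; set m := p * x + (1 - p) * y.
have abs1 a : 0 <= a <= 1 -> `|a * (l * (x - y))| <= 1 / 3.
  case/andP=> a0 a1; rewrite normrM (ger0_norm a0) normrM (ger0_norm l0).
  by rewrite (le_trans _ lc) // (le_trans (ler_piMl _ a1)) ?mulr_ge0 // ler_wpM2l.
have [h0 h1] : (0 <= 1 - p <= 1) /\ (0 <= p <= 1).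
  by rewrite subr_ge0 p0 p1 lerBlDr lerDl p0.
have hx := abs1 _ h0; have hy := abs1 _ h1.
have := expR_le_quad (x := - ((1 - p) * (l * (x - y)))); rewrite normrN => /(_ hx) {}hx.
have {}hy := expR_le_quad hy.
rewrite expRD -(@ler_pM2l _ (expR (l * m))) ?expR_gt0 // mulrA -expRD.
rewrite (_ : l * m + - l * m = 0); last by ring.
rewrite expR0 mul1r mulrDr !(mulrCA (expR (l * m))) -!expRD.
rewrite (_ : l * m + - l * x = - ((1 - p) * (l * (x - y)))); last by rewrite /m; ring.
rewrite (_ : l * m + - l * y = p * (l * (x - y))); last by rewrite /m; ring.
have hc : (l * (x - y)) ^+ 2 <= l ^+ 2 * c ^+ 2.
  rewrite exprMn ler_wpM2l ?sqr_ge0 // -real_normK ?num_real // lerXn2r ?nnegrE //.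
  exact: le_trans xyc.
have := expR_ge1Dx (l ^+ 2 * c ^+ 2).
set t := l * (x - y) in hx hy hc *.
have : p * expR (- ((1 - p) * t)) <= p * (1 + - ((1 - p) * t) + (- ((1 - p) * t)) ^+ 2).
  by apply: ler_wpM2l.
have : (1 - p) * expR (p * t) <= (1 - p) * (1 + p * t + (p * t) ^+ 2).
  by apply: ler_wpM2l; rewrite ?subr_ge0.
have : p * (1 - p) * t ^+ 2 <= t ^+ 2.
  by rewrite ler_piMl ?sqr_ge0 //; nra.
have : p * (1 + - ((1 - p) * t) + (- ((1 - p) * t)) ^+ 2)
  + (1 - p) * (1 + p * t + (p * t) ^+ 2) = 1 + p * (1 - p) * t ^+ 2 by ring.
lra.
Qed.

(** Martingale argument: the two conditional means after exposing the head [e] differ by at most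
    [c e], so [bernoulli_mgf] combines the two inductive bounds. *)
Lemma bexp_mgf (s : seq E) (f : {set E} -> R) (c : E -> R) (l : R) : uniq s ->
  0 <= l -> (forall e, e \in s -> l * c e <= 1 / 3) ->
  (forall e (S S' : {set E}), e \in s -> {in predC1 e, S =i S'} -> `|f S - f S'| <= c e) ->
  bexp p s (fun S => expR (- l * f S))
  <= expR (- l * bexp p s f + l ^+ 2 * \sum_(e <- s) c e ^+ 2).
Proof.
move=> + l0; elim: s f => [|e s IH] f /=; first by rewrite big_nil mulr0 addr0.
case/andP=> es us lc lip; rewrite big_cons.
set f1 := fun S => f (e |: S); set f0 := fun S => f (S :\ e).
have lip' g : (g = f1 \/ g = f0) -> forall e' (S S' : {set E}), e' \in s -> {in predC1 e', S =i S'} ->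
    `|g S - g S'| <= c e'.
  move=> gE e' S S' e's SS'; case: gE => ->; apply: lip; rewrite ?inE ?e's ?orbT //.
    by move=> x xe; rewrite !inE SS'.
  by move=> x xe; rewrite !inE SS'.
have lc' e' : e' \in s -> l * c e' <= 1 / 3 by move=> e's; apply: lc; rewrite inE e's orbT.
have I1 := IH f1 us lc' (lip' f1 (or_introl erefl)).
have I0 := IH f0 us lc' (lip' f0 (or_intror erefl)).
have m_near : `|bexp p s f1 - bexp p s f0| <= c e.
  have H S : - c e <= f1 S - f0 S <= c e.
    rewrite -ler_norml; apply: lip; first by rewrite inE eqxx.
    by move=> x; rewrite !inE => /negbTE ->.
  have -> : bexp p s f1 - bexp p s f0 = bexp p s (fun S => f1 S + -1 * f0 S).
    by rewrite bexpD bexpZ; ring.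
  rewrite ler_norml -{1}(bexp_cst p s (- c e)) -{2}(bexp_cst p s (c e)).
  by apply/andP; split; apply: le_bexp => // S; have /andP[] := H S; rewrite mulN1r.
have := @bernoulli_mgf _ _ _ _ m_near l0 (lc e (mem_head _ _)).
set X := expR _ => HX; set v := \sum_(_ <- _) _ in I1 I0 *.
rewrite [_ * (_ + v)]mulrDr addrA expRD; set w := l ^+ 2 * v in I1 I0 *.
apply: le_trans (ler_wpM2r (expR_ge0 _) HX).
by rewrite [leRHS]mulrDl -!mulrA -!expRD; apply: lerD; apply: ler_wpM2l; rewrite ?subr_ge0 //.
Qed.

(** Markov's inequality applied to exp(-l f). *)
Lemma bexp_lower_tail (s : seq E) (f : {set E} -> R) (c : E -> R) (l t : R) : uniq s ->
  0 <= l -> (forall e, e \in s -> l * c e <= 1 / 3) ->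
  (forall e (S S' : {set E}), e \in s -> {in predC1 e, S =i S'} -> `|f S - f S'| <= c e) ->
  bexp p s (fun S => (f S <= bexp p s f - t)%R%:R)
  <= expR (- l * t + l ^+ 2 * \sum_(e <- s) c e ^+ 2).
Proof.
move=> us l0 lc lip; set m := bexp p s f.
have := bexp_mgf us l0 lc lip; rewrite -/m; set v := l ^+ 2 * _ => H.
have -> : - l * t + v = l * (m - t) + (- l * m + v) by ring.
rewrite expRD; apply: le_trans (ler_wpM2l (expR_ge0 _) H).
rewrite -bexpZ; apply: le_bexp => // S; rewrite -expRD.
case: (boolP (f S <= m - t)) => /= fS; last exact: expR_ge0.
apply: le_trans (expR_ge1Dx _); rewrite lerDl.
have := ler_wpM2l l0 fS; lra.
Qed.

End Concentration.

(** Weigh each subset by [x ^+ #|S|] with [x <= 1]: each small one weighs at least [x ^+ r], and all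
    together weigh [(1 + x) ^+ #|D|]. Half of the exponent pays for this total, and [K] is so large
    that the other half pays for the inverse of [x ^+ r]. *)
Lemma few_small_subsets (R : realType) (eta : R) : 0 < eta ->
  exists K : nat, forall (T : finType) (D : {set T}) (r : nat), (K.+1 * r <= #|D|)%N ->
    #|[set S : {set T} | (S \subset D) && (#|S| <= r)%N]|%:R <= expR (eta * #|D|%:R).
Proof.
move=> eta0; pose x : R := Num.min (eta / 2) 1.
have x0 : 0 < x by rewrite lt_min ltr01 divr_gt0.
have x1 : x <= 1 by rewrite ge_min lexx orbT.
have xe : x <= eta / 2 by rewrite ge_min lexx.
exists (Num.truncn (ln x^-1 * 2 / eta)) => T D r KD.
set K := (_.+1) in KD; set N := #|_|.
have hK : ln x^-1 <= eta / 2 * K%:R.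
  have /ltW := truncnS_gt (ln x^-1 * 2 / eta); rewrite -/K.
  by rewrite ler_pdivrMr // => h; lra.
have xr : x^-1 ^+ r <= expR (eta / 2 * #|D|%:R).
  rewrite -[x^-1]lnK ?posrE ?invr_gt0 // -expRM_natl ler_expR.
  apply: (@le_trans _ _ (r%:R * (eta / 2 * K%:R))); first by rewrite ler_wpM2l.
  rewrite mulrCA ler_wpM2l ?divr_ge0 ?(ltW eta0) // -natrM ler_nat mulnC //.
have Nx : N%:R * x ^+ r <= expR (eta / 2 * #|D|%:R).
  apply: (@le_trans _ _ ((1 + x) ^+ #|D|)); last first.
    rewrite expRM_natr lerXn2r ?nnegrE ?expR_ge0 ?addr_ge0 ?(ltW x0) //.
    by apply: le_trans (expR_ge1Dx _); rewrite lerD2l.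
  rewrite -sum_subsets_exp /N -sum1_card natr_sum mulr_suml.
  rewrite [leRHS](bigID (fun S : {set T} => #|S| <= r)%N) /= -[leLHS]addr0; apply: lerD.
    rewrite (eq_bigl (fun S : {set T} => (S \subset D) && (#|S| <= r)%N)) => [|S]; last by rewrite inE.
    by apply: ler_sum => S /andP[_ Sr]; rewrite mul1r ler_wiXn2l // ltW.
  by apply: sumr_ge0 => S _; rewrite exprn_ge0 // ltW.
have -> : eta * #|D|%:R = eta / 2 * #|D|%:R + eta / 2 * #|D|%:R by field.
rewrite expRD; apply: le_trans (ler_pM _ _ Nx xr).
- by rewrite -mulrA -exprMn divff ?gt_eqF // expr1n mulr1.
- by rewrite mulr_ge0 // exprn_ge0 // ltW.
- by rewrite exprn_ge0 // invr_ge0 ltW.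
Qed.

(** * The lower bound *)

Lemma coarse_edges_pairs (T : finType) (W : {set T}) (B Y : {set T * T}) (K : nat)
    (E : {set {set T}}) :
  starless_cover E W B Y -> coarse_edges B (coarse_part B K Y) \subset pairs T.
Proof.
case=> _ _ _ edge _ _; apply/subsetP => e /imsetP[[[i u] [j v]]].
rewrite !inE /= => /and3P[uB /andP[vY _] /eqP ij] ->.
by rewrite -ij in vY; have [uv _] := edge _ _ _ uB vY; rewrite cards2 uv.
Qed.

Lemma card_pairs_sub (T : finType) (W : {set T}) :
  (#|[set e in pairs T | e \subset W]| <= #|W| ^ 2)%N.
Proof.
have -> : [set e in pairs T | e \subset W] = [set e : {set T} | e \subset W & #|e| == 2].
  by apply/setP => e; rewrite !inE andbC.
rewrite cards_draws bin2 -mulnn; case: #|W| => [|m]; first by [].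
by rewrite -divn2 /=; apply: leq_trans (leq_div _ _) _; rewrite leq_mul2l leqnSn orbT.
Qed.

Section FixedVertexSet.
Variables (R : realType) (p : R) (T : finType) (W : {set T}).
Hypotheses (p0 : 0 < p) (p2 : p <= 1 / 2).
Notation P := (bexp p (enum (pairs T))).
Notation m := (#|W|%:R : R).

Lemma uncovered_lower_tail (B : {set T * T}) (K D : nat) (c0 : R) :
  B \subset setX W W -> 0 <= c0 -> c0 <= 1 ->
  c0 * m ^+ 2 <= P (fun S => #|uncovered W B K D S|%:R) ->
  P (fun S => (#|uncovered W B K D S|%:R <= c0 / 2 * m ^+ 2)%R%:R)
  <= expR (- (c0 ^+ 2 / (16 * (2 + 4 * (D * K))%:R ^+ 2)) * m ^+ 2).
Proof.
move=> BW c0_ge0 c0_le1 mu; set L : R := (2 + 4 * (D * K))%:R.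
have L2 : 2 <= L by rewrite /L ler_nat leq_addr.
have p_ge0 := ltW p0; have p_le1 : p <= 1 by move: p2; lra.
pose f S : R := #|uncovered W B K D S|%:R.
pose c (e : {set T}) : R := if e \subset W then L else 0.
(* The minimiser of the exponent - l t + l^2 L^2 m^2 at the deviation t = c0 m^2 / 2. *)
pose l : R := c0 / (4 * L ^+ 2).
have L0 : L != 0 by rewrite gt_eqF //; lra.
have l0 : 0 <= l by rewrite divr_ge0 // mulr_ge0 ?sqr_ge0.
have lL : l * L <= 1 / 3.
  rewrite (_ : l * L = c0 / (4 * L)); last by rewrite /l; field.
  by rewrite ler_pdivrMr; lra.
have lc e : e \in enum (pairs T) -> l * c e <= 1 / 3.
  by rewrite /c => _; case: ifP => // _; rewrite mulr0; lra.
have lip (e : {set T}) (S S' : {set {set T}}) : e \in enum (pairs T) -> {in predC1 e, S =i S'} ->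
    `|f S - f S'| <= c e.
  move=> _ SS'; have S'S : {in predC1 e, S' =i S} by move=> x xe; rewrite SS'.
  have := uncovered_lipschitz K D BW SS'; have := uncovered_lipschitz K D BW S'S.
  rewrite -!(ler_nat R) !natrD (_ : (if _ then _ else _)%:R = c e); last by rewrite /c; case: ifP.
  by rewrite ler_norml -/(f S) -/(f S') => h1 h2; apply/andP; split; lra.
have tail := bexp_lower_tail p_ge0 p_le1 (c0 / 2 * m ^+ 2) (enum_uniq _) l0 lc lip.
apply: le_trans (le_trans tail _); last first.
  rewrite ler_expR.
  have sc : \sum_(e <- enum (pairs T)) c e ^+ 2 <= L ^+ 2 * m ^+ 2.
    apply: (@le_trans _ _ (\sum_(e in [set e in pairs T | e \subset W]) L ^+ 2)).
      rewrite big_enum [leLHS]big_mkcond [leRHS]big_mkcond /=; apply: ler_sum => e _.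
      rewrite [e \in [set _ in _ | _]]inE /c; case: (e \in pairs T) => //=.
      by case: ifP; rewrite ?expr0n.
    by rewrite sumr_const -[leLHS]mulr_natr ler_wpM2l ?sqr_ge0 // -natrX ler_nat card_pairs_sub.
  have := ler_wpM2l (sqr_ge0 l) sc.
  have -> : l ^+ 2 * (L ^+ 2 * m ^+ 2) = c0 ^+ 2 / (16 * L ^+ 2) * m ^+ 2.
    by rewrite /l; field.
  have -> : - l * (c0 / 2 * m ^+ 2) = - (c0 ^+ 2 / (8 * L ^+ 2) * m ^+ 2).
    by rewrite /l; field.
  have -> : c0 ^+ 2 / (8 * L ^+ 2) = 2 * (c0 ^+ 2 / (16 * L ^+ 2)) by field.
  by move=> h; lra.
apply: le_bexp => // S; rewrite ler_nat; case: leP => //= h.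
by rewrite (_ : f S <= _ = true) //; apply: le_trans h _; move: mu; rewrite -/f; lra.
Qed.

(** A fixed set of at least [eps] pairs is present with probability at most p^eps; the union bound
    counts the choices of [B] and [C]. *)
Lemma coarse_edges_unlikely (eps : R) (Bs Cs : {set {set T * T}}) :
  0 <= eps ->
  P (fun S => [exists (B | B \in Bs), exists (C | C \in Cs),
     [&& eps <= #|coarse_edges B C|%:R, coarse_edges B C \subset pairs T
       & coarse_edges B C \subset S]]%:R)
  <= #|Bs|%:R * #|Cs|%:R * expR (ln p * eps).
Proof.
move=> eps0; have p_ge0 := ltW p0; have p_le1 : p <= 1 by move: p2; lra.
have lnp : ln p <= 0 by apply: ln_le0.
have one (F : {set {set T}}) :
    P (fun S => [&& eps <= #|F|%:R, F \subset pairs T & F \subset S]%:R) <= expR (ln p * eps).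
  have [/andP[Fe FP]|no] := boolP ((eps <= #|F|%:R) && (F \subset pairs T)); last first.
    rewrite (@eq_bexp _ _ _ _ _ (fun=> 0)) ?bexp_cst ?expR_ge0 // => S.
    by rewrite andbA (negbTE no).
  apply: (@le_trans _ _ (p ^+ #|F|)); last first.
    by rewrite -[p in leLHS]lnK ?posrE // -expRM_natr ler_expR ler_wnM2l.
  have := cylinder_le p0 p2 FP (sub0set _); rewrite cards0 expr0 mulr1; apply: le_trans.
  apply: le_bexp => // S; rewrite Fe FP /= disjoint_sym.
  by rewrite (_ : [disjoint S & set0]) ?andbT // disjoint_sym -setI_eq0 set0I.
apply: le_trans (bexp_exists p_ge0 p_le1 _ _ _) _.
apply: (@le_trans _ _ (\sum_(B in Bs) (#|Cs|%:R * expR (ln p * eps)))); last first.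
  by rewrite sumr_const -[leLHS]mulr_natl mulrA.
apply: ler_sum => B _; apply: le_trans (bexp_exists p_ge0 p_le1 _ _ _) _.
by rewrite mulr_natl -sumr_const; apply: ler_sum => C _; apply: one.
Qed.

End FixedVertexSet.

(** The event [A] quantifies over sparse [B] and sparse [C] only: the other sides enter through
    their coarse part alone, which makes the union bound affordable. *)
Lemma starless_cover_unlikely (R : realType) (p : R) : 0 < p -> p <= 1 / 2 ->
  exists (c : R) (M : nat), 0 < c /\ forall (T : finType) (W : {set T}), (M <= #|W|)%N ->
    exists A : pred {set {set T}},
      (forall E B Y, starless_cover E W B Y -> A E) /\
      bexp p (enum (pairs T)) (fun S => (A S)%:R) <= expR (- c * #|W|%:R ^+ 2).
Proof.
move=> p0 p2; have p_ge0 := ltW p0; have p_le1 : p <= 1 by lra.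
have lnp : ln p < 0 by rewrite -ln1 ltr_ln ?posrE //; lra.
have q_gt0 : 0 < 1 - p by lra.
have q_le1 : 1 - p <= 1 by lra.
have [c0 c0E] : exists c0 : R, c0 = p * (1 - p) ^+ 448 / 16 by eexists.
have c0_gt0 : 0 < c0 by rewrite c0E divr_gt0 // mulr_gt0 // exprn_gt0.
have c0_le1 : c0 <= 1.
  rewrite c0E ler_pdivrMr // mul1r; apply: (@le_trans _ _ 1); last by rewrite ler1n.
  by rewrite mulr_ile1 ?exprn_ge0 ?exprn_ile1 // ltW.
pose eps : R := c0 / 16.
pose b1 : R := eps * - ln p.
have b1_gt0 : 0 < b1 by rewrite mulr_gt0 ?oppr_gt0 ?divr_gt0.
(* With this [K] the choices of [C] cost exp(b1 m^2 / 4), against the gain exp(-b1 m^2) in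
   [coarse_edges_unlikely]. *)
have [K0 HK] := @few_small_subsets R (b1 / 4) (divr_gt0 b1_gt0 (ltr0n _ 4)).
pose K := K0.+1.
(* This [D] makes the hubs so few that the bound of [card_hub_pairs] is at most c0 m^2 / 16. *)
pose D := Num.truncn (16 * K%:R ^+ 2 / c0 : R).
have HD : 16 * K%:R ^+ 2 <= c0 * D.+1%:R.
  by have /ltW := truncnS_gt (16 * K%:R ^+ 2 / c0); rewrite ler_pdivrMr // [X in _ <= X -> _]mulrC.
pose b2 : R := c0 ^+ 2 / (16 * (2 + 4 * (D * K))%:R ^+ 2).
have b2_gt0 : 0 < b2 by rewrite divr_gt0 ?exprn_gt0 // mulr_gt0 ?exprn_gt0 ?ltr0n.
(* The choices of [B] must be beaten by both tails, and [b2] depends on [K] and [D]; so the sparsity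
   [K'] of [B] is fixed last. *)
pose b := Num.min (b1 / 4) (b2 / 2).
have b_gt0 : 0 < b by rewrite lt_min; apply/andP; split; apply: divr_gt0.
have bb1 : b <= b1 / 4 by rewrite ge_min lexx.
have bb2 : b <= b2 / 2 by rewrite ge_min lexx orbT.
have [K0' HK'] := @few_small_subsets R b b_gt0.
pose K' := K0'.+1.
(* The 4 is for [expected_uncovered], [K' ^ 2] for [card_cover_left], and 2 / b lets exp(b m^2 / 2)
   absorb the factor 2 from the two bad events. *)
exists (b / 2), (maxn 4 (maxn (K' ^ 2) (Num.truncn (2 / b)).+1)); split; first by apply: divr_gt0.
move=> T W; rewrite !geq_max => /and3P[W4 WK' Wb].
pose WW := setX W W; pose m : R := #|W|%:R.
have cWW : #|WW|%:R = m ^+ 2 by rewrite /WW cardsX natrM expr2.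
pose Bs := [set B : {set T * T} | (B \subset WW) && (#|B| <= #|WW| %/ K')%N].
pose Cs := [set C : {set T * T} | (C \subset WW) && (#|C| <= #|WW| %/ K)%N].
have Bs_le : #|Bs|%:R <= expR (b * m ^+ 2).
  by rewrite -cWW; apply: HK'; rewrite mulnC leq_divM.
have Cs_le : #|Cs|%:R <= expR (b1 / 4 * m ^+ 2).
  by rewrite -cWW; apply: HK; rewrite mulnC leq_divM.
pose bad1 (S : {set {set T}}) := [exists (B | B \in Bs), exists (C | C \in Cs),
     [&& eps * m ^+ 2 <= #|coarse_edges B C|%:R, coarse_edges B C \subset pairs T
       & coarse_edges B C \subset S]].
pose bad2 (S : {set {set T}}) := [exists (B | B \in Bs),
   (#|uncovered W B K D S|%:R <= c0 / 2 * m ^+ 2)%R].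
exists (fun S => bad1 S || bad2 S); split.
  move=> E B Y cov; have [BW YW _ _ _ _] := cov.
  have BBs : B \in Bs.
    by rewrite inE BW leq_divRL // mulnC cardsX mulnn; apply: card_cover_left cov WK'.
  have CCs : coarse_part B K Y \in Cs.
    rewrite inE leq_divRL // mulnC cardsX mulnn (card_coarse_part K BW cov) andbT.
    by apply: subset_trans YW; apply/subsetP => z; rewrite inE => /andP[].
  apply/orP; have [h|h] := leP (eps * m ^+ 2) #|coarse_edges B (coarse_part B K Y)|%:R; [left|right].
    apply/exists_inP; exists B => //; apply/exists_inP; exists (coarse_part B K Y) => //.
    by rewrite h (coarse_edges_sub _ cov) (coarse_edges_pairs _ cov).
  apply/exists_inP; exists B => //.
  have HU := card_uncovered K D cov; have Hh := card_hubs K D BW.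
  set H := #|hubs W B K D| in HU Hh; set CE := #|coarse_edges _ _| in HU h.
  move: HU Hh; rewrite -!(ler_nat R) natrD !natrM -/m => HU Hh.
  set d : R := D.+1%:R in Hh HD; have d_gt0 : 0 < d by rewrite /d.
  (* Then at most (2/16 + 2/16) c0 m^2 pairs are uncovered, below the threshold c0 m^2 / 2. *)
  suff : 16 * (m * (H%:R * K%:R)) <= c0 * m ^+ 2.
    have : 0 <= c0 * m ^+ 2 by rewrite mulr_ge0 ?sqr_ge0 // ltW.
    move: HU h; rewrite /eps; move: (m ^+ 2) (m * (H%:R * K%:R)) => x y; clear -R; lra.
  rewrite -(ler_pM2l d_gt0).
  apply: (@le_trans _ _ (16 * K%:R * m * (K%:R * m))).
    rewrite (_ : d * _ = 16 * K%:R * m * (d * H%:R)); last by ring.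
    by rewrite ler_wpM2l // !mulr_ge0.
  rewrite (_ : 16 * _ * _ * _ = 16 * K%:R ^+ 2 * m ^+ 2); last by ring.
  by rewrite [leRHS]mulrA (mulrC d); apply: ler_wpM2r HD; rewrite sqr_ge0.
have m2_ge : 2 / b <= m ^+ 2.
  apply: (@le_trans _ _ m); last by rewrite expr2 ler_peMl // ler1n (leq_trans _ W4).
  by apply: le_trans (ltW (truncnS_gt _)) _; rewrite ler_nat.
have P1 := coarse_edges_unlikely p0 p2 Bs Cs (eps := eps * m ^+ 2).
have P2 : bexp p (enum (pairs T)) (fun S => (bad2 S)%:R) <= expR (- b * m ^+ 2).
  apply: le_trans (bexp_exists p_ge0 p_le1 _ _ _) _.
  apply: (@le_trans _ _ (\sum_(B in Bs) expR (- b2 * m ^+ 2))).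
    apply: ler_sum => B; rewrite inE => /andP[BW _].
    apply: uncovered_lower_tail => //; first exact: ltW.
    by rewrite c0E; apply: expected_uncovered.
  rewrite sumr_const -[leLHS]mulr_natl.
  apply: (le_trans (ler_wpM2r (expR_ge0 _) Bs_le)); rewrite -expRD ler_expR -mulrDl.
  rewrite ler_wpM2r ?sqr_ge0 //; move: bb2; move: (b) (b2) => x y; clear -R; lra.
have {}P1 : bexp p (enum (pairs T)) (fun S => (bad1 S)%:R) <= expR (- b * m ^+ 2).
  apply: (le_trans (P1 _)); first by rewrite mulr_ge0 ?sqr_ge0 // divr_ge0 // ltW.
  apply: (@le_trans _ _ (expR (b * m ^+ 2) * expR (b1 / 4 * m ^+ 2) * expR (ln p * (eps * m ^+ 2)))).
    by rewrite ler_wpM2r ?expR_ge0 // ler_pM.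
  rewrite -!expRD ler_expR mulrA -!mulrDl ler_wpM2r ?sqr_ge0 //.
  have -> : ln p * eps = - b1 by rewrite /b1; ring.
  by move: bb1 b_gt0; move: (b) (b1) => x y; clear -R; lra.
apply: (@le_trans _ _ (2 * expR (- b * m ^+ 2))).
  rewrite mulr2n mulrDl !mul1r; apply: le_trans (lerD P1 P2); rewrite -bexpD.
  apply: le_bexp => // S; case: (bad1 S) => /=; last by rewrite add0r.
  by rewrite lerDl.
rewrite (_ : - b * m ^+ 2 = - (b / 2) * m ^+ 2 + - (b / 2 * m ^+ 2)); last by field.
rewrite expRD mulrCA -[leRHS]mulr1 ler_wpM2l ?expR_ge0 // expRN ler_pdivrMr ?expR_gt0 // mul1r.
apply: le_trans (expR_ge1Dx _); move: m2_ge; rewrite ler_pdivrMr //.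
by move: (b) (m ^+ 2) => y x; clear -R; lra.
Qed.

(** For [k <= #|W|] the failure probability at [W] is at most [expR (- c * k%:R) ^+ #|W|]; the sum
    over all nonempty [W] has the closed form stated. *)
Lemma tau_lower_prob (R : realType) (p : R) : 0 < p -> p <= 1 / 2 ->
  exists (c : R) (M : nat), 0 < c /\ forall n k, (M <= k)%N -> (0 < k)%N ->
    Gnp_prob p (fun G : sgraph 'I_n => (tau G + k <= n)%N) <= (1 + expR (- c * k%:R)) ^+ n - 1.
Proof.
move=> p0 p2; have [c [M [c0 H]]] := starless_cover_unlikely p0 p2.
exists c, M; split => // n k Mk k0; have p_ge0 := ltW p0; have p_le1 : p <= 1 by lra.
have /choice[A HA] : forall W : {set 'I_n}, exists A : pred {set {set 'I_n}}, (k <= #|W|)%N ->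
    (forall E B Y, starless_cover E W B Y -> A E) /\
    bexp p (enum (pairs 'I_n)) (fun S => (A S)%:R) <= expR (- c * #|W|%:R ^+ 2).
  move=> W.
  have [kW|kW] := leqP k #|W|; last by exists predT => h.
  by have [A HA] := H _ W (leq_trans Mk kW); exists A.
apply: (@le_trans _ _ (bexp p (enum (pairs 'I_n))
    (fun S => [exists (W : {set 'I_n} | (k <= #|W|)%N), A W S]%:R))).
  apply: Gnp_prob_le => // G tG; have [P [PG PE]] := tauP G.
  have [|W [B [Y [kW cov]]]] := @exists_starless_cover _ G P k PG; first by rewrite PE card_ord.
  by apply/exists_inP; exists W => //; have [h _] := HA W kW; apply: h cov.
apply: le_trans (bexp_exists p_ge0 p_le1 _ _ _) _.
have -> : (1 + expR (- c * k%:R)) ^+ n - 1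
    = \sum_(W : {set 'I_n} | W != set0) expR (- c * k%:R) ^+ #|W|.
  have := sum_subsets_exp [set: 'I_n] (expR (- c * k%:R)); rewrite cardsT card_ord => <-.
  rewrite (bigD1 set0) ?sub0set //= cards0 expr0 addrAC subrr add0r.
  by apply: eq_bigl => W; rewrite subsetT.
rewrite [leLHS]big_mkcond [leRHS]big_mkcond /=; apply: ler_sum => W _.
case: ifPn => [kW|_]; last by case: ifP => _ //; rewrite exprn_ge0 ?expR_ge0.
have W0 : W != set0 by rewrite -card_gt0 (leq_trans k0).
rewrite W0; have [_ h] := HA W kW; apply: le_trans h _.
rewrite -expRM_natr ler_expR -mulrA expr2 !mulNr lerN2 ler_wpM2l ?(ltW c0) //.
by rewrite ler_wpM2r // ler_nat.
Qed.

Lemma near_large_ln (R : realType) (X : R) (P : nat -> Prop) :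
  (forall n : nat, (0 < n)%N -> X <= ln n%:R -> P n) -> (\forall n \near \oo, P n)%classic.
Proof.
move=> HP; exists (Num.truncn (expR X)).+1 => // n /= Xn; apply: HP.
  exact: leq_trans Xn.
rewrite -[X]expRK ler_ln ?posrE ?expR_gt0 ?ltr0n ?(leq_trans _ Xn) //.
by apply: ltW; apply: lt_le_trans (truncnS_gt _) _; rewrite ler_nat.
Qed.

Lemma expR_ge_pow5 (R : realType) (w : R) : 0 <= w -> w ^+ 5 / 120 <= expR w.
Proof.
move=> w0; have := expR_ge1Dxn 4 w0; have -> : (5`!)%:R = 120 :> R by [].
by apply: le_trans; rewrite lerDr.
Qed.

(** The fifth power in [expR_ge_pow5] beats s^2 = O(w^4); [w] will be half the square root of ln
    n. *)
Lemma upper_rate (R : realType) (C w s : R) : 0 < w -> 0 <= s -> s <= C * w ^+ 2 ->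
  expR (- w) * s * s <= 120 * C ^+ 2 / w.
Proof.
move=> w0 s0 sC; rewrite expRN -mulrA mulrC ler_pdivrMr ?expR_gt0 //.
have := expR_ge_pow5 (ltW w0) => H.
apply: (@le_trans _ _ ((C * w ^+ 2) * (C * w ^+ 2))); first by rewrite ler_pM.
apply: (@le_trans _ _ (120 * C ^+ 2 / w * (w ^+ 5 / 120))); last first.
  by rewrite ler_wpM2l // divr_ge0 ?(ltW w0) // mulr_ge0 ?sqr_ge0.
by rewrite le_eqVlt; apply/orP; left; apply/eqP; field; rewrite gt_eqF.
Qed.

Lemma exprD1_le (R : realType) (x : R) (n : nat) : 0 <= x -> (1 + x) ^+ n <= expR (x * n%:R).
Proof.
by move=> x0; rewrite expRM_natr lerXn2r ?nnegrE ?expR_ge0 ?addr_ge0 // expR_ge1Dx.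
Qed.

(** * Asymptotics *)

Section Rates.
Variables (R : realType) (p : R).
Hypotheses (p0 : 0 < p) (p2 : p <= 1 / 2).

(* The error term is [o n = - 1 / sqrt (ln n)]. *)
Definition sqrt_ln (n : nat) : R := Num.sqrt (ln n%:R).

Lemma sqrt_ln_ge (X : R) (n : nat) : 0 <= X -> (0 < n)%N -> X ^+ 2 <= ln n%:R -> X <= sqrt_ln n.
Proof.
move=> X0 n0 Xn; rewrite -(@ler_pXn2r _ 2) ?nnegrE ?sqrtr_ge0 // sqr_sqrtr //.
by apply: ln_ge0; rewrite ler1n.
Qed.

Lemma upper_fails_rarely (e : R) : 0 < e ->
  (\forall n \near \oo, Gnp_prob p (fun G : sgraph 'I_n =>
     ~~ ((tau G)%:R <= n%:R - (2 + - (sqrt_ln n)^-1) * logb (1 / (1 - p)) n%:R)) <= e)%classic.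
Proof.
move=> e0; have p1 : p < 1 by move: p2; lra.
have q0 : 0 < 1 - p by rewrite subr_gt0.
pose b := ln (1 / (1 - p)).
have b0 : 0 < b by rewrite ln_gt0 // ltr_pdivlMr // mul1r; move: p0; lra.
pose h := ln (1 + e); have h0 : 0 < h by rewrite ln_gt0 // ltrDl.
pose C : R := 8 / b + 1.
have C0 : 0 < C by rewrite addr_gt0 ?divr_gt0.
(* A lower bound for [w]: the middle term brings [upper_rate] below [h], and the last one gives
   [s <= n]. *)
pose W := Num.max 1 (Num.max (120 * C ^+ 2 / h) C).
apply: (@near_large_ln _ ((2 * W) ^+ 2)) => n n0 Wn.
have W1 : 1 <= W by rewrite le_max lexx.
have W0 : 0 <= W by apply: le_trans W1.
(* In terms of [w], n = exp(4 w^2) and b y = 8 w^2 - 2 w, so that exp(b y / 2) / n = exp(-w). *)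
pose w := sqrt_ln n / 2.
have Ww : W <= w.
  by rewrite ler_pdivlMr // mulrC; apply: sqrt_ln_ge => //; rewrite mulr_ge0.
have w0 : 0 < w by apply: lt_le_trans Ww; apply: lt_le_trans W1.
have lnE : ln n%:R = 4 * w ^+ 2 :> R.
  rewrite /w expr_div_n sqr_sqrtr; last by apply: ln_ge0; rewrite ler1n.
  by field.
have nE : n%:R = expR (4 * w ^+ 2) :> R by rewrite -lnE lnK // posrE ltr0n.
pose y : R := (2 + - (sqrt_ln n)^-1) * logb (1 / (1 - p)) n%:R.
have yE : b * y = 8 * w ^+ 2 - 2 * w.
  rewrite /y /logb lnE -/b (_ : sqrt_ln n = 2 * w); last by rewrite /w; field.
  by field; rewrite !gt_eqF.
have y0 : 0 <= y.
  rewrite -(pmulr_rge0 _ b0) yE.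
  have : W <= w by []. have : 0 <= w * (w - 1) by rewrite mulr_ge0 ?subr_ge0 ?(ltW w0) ?(le_trans W1).
  by rewrite expr2; nra.
(* One more than the integer part: [s] exceeds [y], as the bound on [tau] requires, while
   [s.-1 <= y] controls the overlaps. *)
pose s := (Num.truncn y).+1.
have /andP[sy ys] := truncn_itv y0; rewrite -/s in ys.
have sC : s%:R <= C * w ^+ 2.
  have w1 : 1 <= w ^+ 2 by rewrite exprn_ege1 // (le_trans W1).
  rewrite -natr1; apply: (@le_trans _ _ (8 / b * w ^+ 2 + 1)); last by rewrite /C; lra.
  rewrite lerD2r (le_trans sy) // -(ler_pM2l b0) yE.
  rewrite (_ : b * _ = 8 * w ^+ 2); last by field; rewrite gt_eqF.
  by rewrite lerBlDr lerDl mulr_ge0 // ltW.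
have sn : (s <= n)%N.
  rewrite -(ler_nat R) (le_trans sC) // nE.
  have w4 : 0 <= 4 * w ^+ 2 by rewrite mulr_ge0 ?sqr_ge0.
  have := expR_ge1Dxn 1 w4; rewrite (_ : (2`!)%:R = 2) //.
  have : C <= w by apply: le_trans Ww; rewrite !le_max lexx !orbT.
  have : 1 <= w by apply: le_trans Ww.
  move: (w) (C) C0 => v D D0 v1 Dv; apply: le_trans.
  have : D * v ^+ 2 <= v * v ^+ 2 by rewrite ler_wpM2r ?sqr_ge0.
  have : v ^+ 3 <= v ^+ 4 by rewrite ler_weXn2l.
  have -> : (4 * v ^+ 2) ^+ 2 = 16 * v ^+ 4 by ring.
  have -> : v * v ^+ 2 = v ^+ 3 by ring.
  have : 0 <= v ^+ 4 by rewrite exprn_ge0 // (le_trans _ v1).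
  by lra.
pose x := expR (b * y / 2).
have bx : (1 - p)^-1 ^+ s.-1 <= x ^+ 2.
  rewrite -[(1 - p)^-1]div1r -[1 / (1 - p)]lnK ?posrE ?divr_gt0 // -/b -expRM_natr /x -expRM_natr.
  rewrite ler_expR (_ : b * y / 2 * 2 = b * y); last by field.
  by rewrite ler_wpM2l // ltW.
have := @tau_upper_prob R n p s x (ltW p0) p1 sn (expR_ge0 _) bx; set F := fun _ => _.
move=> H; apply: le_trans (le_trans H _).
  rewrite /Gnp_prob [leLHS]big_mkcond [leRHS]big_mkcond /=; apply: ler_sum => G _.
  have w_ge0 : 0 <= Gnp_weight p G.
    by apply: prodr_ge0 => f _; case: ifP; rewrite ?subr_ge0 ltW.
  case: ifPn => nG; case: ifPn => // FG; exfalso; move: nG; apply/negP; rewrite negbK.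
  move: FG; rewrite negbK -(ler_nat R) natrD -/y lerBrDr; apply: le_trans.
  by rewrite lerD2l ltW.
have xs : x * s%:R / n%:R = expR (- w) * s%:R.
  rewrite nE mulrAC -expRN -expRD; congr (expR _ * _); rewrite yE; by field.
rewrite xs lerBlDl; apply: le_trans (exprD1_le _ _) _; first by rewrite mulr_ge0 ?expR_ge0.
rewrite -[leRHS]lnK ?posrE ?addr_gt0 // ler_expR -/h.
apply: le_trans (upper_rate w0 _ sC) _ => //.
rewrite ler_pdivrMr // -ler_pdivrMl // mulrC.
by apply: le_trans Ww; rewrite !le_max lexx !orbT.
Qed.

Lemma lower_fails_rarely (c eps e : R) : 0 < c -> 0 < eps -> 0 < e ->
  (\forall n \near \oo, Gnp_prob p (fun G : sgraph 'I_n =>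
     ~~ (n%:R - c * (logb (1 / p) n%:R) `^ (3 + eps) <= (tau G)%:R)) <= e)%classic.
Proof.
move=> c0 eps0 e0; have [a [M [a0 H]]] := tau_lower_prob p0 p2.
pose l := ln (1 / p).
have l0 : 0 < l by rewrite ln_gt0 // ltr_pdivlMr // mul1r; move: p2; lra.
pose h := ln (1 + e); have h0 : 0 < h by rewrite ln_gt0 // ltrDl.
(* The terms ensure [1 <= x / l], so that the power 3 + eps dominates the square, [1 <= x], 1 / x <=
   h, and that c (x / l)^2 is at least (2 / a + M + 2) x. *)
pose X := Num.max l (Num.max 1 (Num.max h^-1 ((2 / a + M%:R + 2) * l ^+ 2 / c))).
apply: (@near_large_ln _ X) => n n0; rewrite !ge_max => /and4P[xl x1 xh xc].
set x := ln n%:R in xl x1 xh xc.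
have nE : n%:R = expR x by rewrite lnK // posrE ltr0n.
have x0 : 0 < x by apply: lt_le_trans x1.
pose m0 := c * (logb (1 / p) n%:R) `^ (3 + eps).
have m0_ge : (2 / a + M%:R + 2) * x <= m0.
  apply: (@le_trans _ _ (c * (x / l) ^+ 2)).
    move: xc; rewrite ler_pdivrMr // => xc; rewrite expr_div_n mulrA ler_pdivlMr ?exprn_gt0 //.
    by rewrite mulrAC (expr2 x) mulrA ler_wpM2r ?(ltW x0) // (mulrC c).
  rewrite ler_wpM2l ?(ltW c0) // /logb -/l -/x -powR_mulrn ?divr_ge0 ?(ltW x0) ?(ltW l0) //.
  by apply: ler_powR; [rewrite ler_pdivlMr // mul1r|lra].
have m0_0 : 0 <= m0 by rewrite mulr_ge0 ?powR_ge0 // ltW.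
(* Rounding down loses at most 1 <= x, which turns the constant 2 of [m0_ge] into 1. *)
pose k := Num.truncn m0; have /andP[km mk] := truncn_itv m0_0.
have kx : (2 / a + M%:R + 1) * x <= k%:R.
  by move: mk; rewrite -natr1 => mk; move: m0_ge; rewrite mulrDl => m0_ge; rewrite mulrDl; lra.
have a2 : 0 < 2 / a by rewrite divr_gt0.
have M0 : 0 <= M%:R :> R by [].
have Mk : (M <= k)%N.
  rewrite -(ler_nat R) (le_trans _ kx) //; apply: (@le_trans _ _ (M%:R * x)); first by rewrite ler_peMr.
  by rewrite ler_wpM2r ?(ltW x0) //; lra.
have k0 : (0 < k)%N.
  rewrite -(ltr_nat R) (lt_le_trans _ kx) // mulr_gt0 //; lra.
apply: le_trans (le_trans (H n k Mk k0) _).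
  rewrite /Gnp_prob [leLHS]big_mkcond [leRHS]big_mkcond /=; apply: ler_sum => G _.
  have w_ge0 : 0 <= Gnp_weight p G.
    by apply: prodr_ge0 => f _; case: ifP => _; [exact: ltW|move: p2; lra].
  case: ifPn => nG; case: ifPn => // FG; exfalso; move: nG; apply/negP; rewrite negbK -/m0.
  move: FG; rewrite -ltnNge -(ltr_nat R) natrD lerBlDr => FG.
  by apply: le_trans (ltW FG) _; rewrite lerD2l.
rewrite lerBlDl; apply: le_trans (exprD1_le _ (expR_ge0 _)) _.
rewrite -[leRHS]lnK ?posrE ?addr_gt0 // ler_expR -/h nE -expRD.
(* Since k >= 2 x / a, the quantity n exp(-a k) is at most exp(-x). *)
have e1 : - a * k%:R + x <= - x.
  have : a * ((2 / a) * x) <= a * k%:R.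
    rewrite ler_wpM2l ?(ltW a0) // (le_trans _ kx) // ler_wpM2r ?(ltW x0) //; lra.
  rewrite (_ : a * _ = 2 * x); last by field; rewrite gt_eqF.
  by lra.
apply: (@le_trans _ _ (expR (- x))); first by rewrite ler_expR.
rewrite expRN -[leRHS]invrK lef_pV2 ?posrE ?expR_gt0 ?invr_gt0 //.
by apply: le_trans xh _; apply: le_trans (expR_ge1Dx _); lra.
Qed.

End Rates.

Local Open Scope classical_set_scope.
Local Open Scope ring_scope.

Theorem theorem2 (R : realType) (p : R) (p_gt0 : 0 < p) (p_le : p <= 1 / 2) :
  exists o : nat -> R,
    (o @ \oo --> (0 : R)) /\
    forall c eps : R, 0 < c -> 0 < eps ->
      aas p (fun n (G : sgraph 'I_n) =>
        n%:R - c * (logb (1 / p) n%:R) `^ (3 + eps) <= (tau G)%:R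
          <= n%:R - (2 + o n) * logb (1 / (1 - p)) n%:R).
Proof.
exists (fun n => - (sqrt_ln R n)^-1); split.
  apply/cvgrPdist_le => e e0; apply: (@near_large_ln _ (e^-1 ^+ 2)) => n n0 en.
  have ei : 0 < e^-1 by rewrite invr_gt0.
  have h := sqrt_ln_ge (ltW ei) n0 en; have s0 := lt_le_trans ei h.
  rewrite sub0r opprK ger0_norm ?invr_ge0 ?(ltW s0) //.
  by rewrite -[leRHS]invrK lef_pV2.
move=> c eps c0 eps0; apply/cvgrPdist_le => e e0.
have e2 : 0 < e / 2 by rewrite divr_gt0.
have H1 := upper_fails_rarely p_gt0 p_le e2; have H2 := lower_fails_rarely p_gt0 p_le c0 eps0 e2.
near=> n.
apply: le_trans (@Gnp_prob_union _ _ _ _ (fun G : sgraph 'I_n =>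
     ~~ ((tau G)%:R <= n%:R - (2 + - (sqrt_ln R n)^-1) * logb (1 / (1 - p)) n%:R))
   (fun G : sgraph 'I_n => ~~ (n%:R - c * (logb (1 / p) n%:R) `^ (3 + eps) <= (tau G)%:R))
   (ltW p_gt0) _ _) _; [lra| |].
  by move=> G; case: (_ <= (tau G)%:R) => /=; case: (_ <= _).
rewrite [e]splitr; apply: lerD; near: n; [exact: H1|exact: H2].
Unshelve. all: by end_near.
Qed.
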